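(* Let $\mathcal{A}=\{a_1,\ldots,a_n\}\subset\{(r,s,t)\in(\mathbb{Z}_{\ge 0})^3 : r+s+t=d\}$ be a set of $n$ distinct points with $\operatorname{conv}(\mathcal{A})$ two-dimensional. Let $L$ be a tropical line in $\mathbb{TP}^{n-1}$ that is compatible with $\mathcal{A}$. Assume that $L$ is trivalent and that for each (trivalent) vertex $v$ of $L$ the regular subdivision $\Delta(v)$ of $\operatorname{conv}(\mathcal{A})$ is maximal. Then there exists a configuration $C$ of $n-2$ points in $\mathbb{TP}^2$ that is general with respect to $\mathcal{A}$ such that $L=L_C$. In particular, each point $P\in C$ corresponds to a trivalent vertex of $L$, in the following sense: there are a trivalent vertex $v$ of $L$ and indices $i,j,k$ such that the leaves $i,j,k$ lie in three different components of $L\setminus\{v\}$ and the minimum of $\{v_m+a_m\cdot P\}_{m=1,\ldots,n}$ is attained by the terms with indices $i,j,k$.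
   Context: $\mathbb{TP}^{m}=\mathbb{R}^{m+1}/\mathbb{R}(1,\ldots,1)$. Here $d$ is a fixed integer, $a_i=(r_i,s_i,t_i)$, $n\geq 3$, and for $P=(x,y,z)$ we write $a_i\cdot P=r_ix+s_iy+t_iz$. For $c\in\mathbb{TP}^{n-1}$, the tropical plane curve with support $\mathcal{A}$ and coefficient vector $c$ is $\mathcal{T}(F_c)=\{P\in\mathbb{TP}^2 : \min_{i}\{c_i+a_i\cdot P\}$ is attained by at least two indices $i\}$. Tropical curves with a smaller support set are defined in the same way. A tropical line $L\subset\mathbb{TP}^{n-1}$ is a closed embedded metric tree with exactly $n$ unbounded edges (rays), labelled $1,\ldots,n$, all of whose vertices have valence at least $3$, satisfying the following: if an edge of $L$ splits the label set into $I$ and $I^c$, then the direction of this edge, towards the side of $I$, is $e_I=\sum_{i\in I}e_i$. The leaf $i$ is the point at infinity of the ray labelled $i$ (which has direction $e_i$). $L$ is trivalent if all its vertices have valence exactly $3$. $L$ is compatible with $\mathcal{A}$ if, whenever $(ij|kl)$ is a trivalent subtree of $L$ (i.e. $i,j,k,l$ are distinct leaves and some bounded edge of $L$ separates $\{i,j\}$ from $\{k,l\}$), the convex hull of $a_i,a_j,a_k,a_l$ has at least one of the segments $\operatorname{conv}(a_i,a_j)$ or $\operatorname{conv}(a_k,a_l)$ as an edge. For $c\in\mathbb{TP}^{n-1}$, $\Delta(c)$ is the regular subdivision of $\operatorname{conv}(\mathcal{A})$ obtained by projecting to the first three coordinates the lower faces of $\operatorname{conv}\{(r_i,s_i,t_i,c_i)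 : i=1,\ldots,n\}\subset\mathbb{R}^4$. It is maximal if it cannot be refined further, i.e. it is a triangulation with vertices in $\mathcal{A}$ in which every point of $\mathcal{A}$ is a vertex. A configuration $C=\{P_1,\ldots,P_{n-2}\}\subset\mathbb{TP}^2$ is general with respect to $\mathcal{A}$ if $C$ does not lie on a tropical curve with support $\mathcal{A}\setminus\{a_i,a_j\}$ for any pair $i\ne j$. Equivalently, for every $i\neq j$, the minimum of $\sum_{k=1}^{n-2}a_{\sigma(k)}\cdot P_k$ over all bijections $\sigma:\{1,\ldots,n-2\}\to\{1,\ldots,n\}\setminus\{i,j\}$ is attained by only one $\sigma$. For general $C$, $L_C=\{c\in\mathbb{TP}^{n-1} : P_k\in\mathcal{T}(F_c)\text{ for all }k=1,\ldots,n-2\}$, which is a tropical line.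
   Formalization: In ''compatible'', an edge of the convex hull may contain no other of the four points: a point inside a side subdivides it. With plain sides the claim is false, e.g. for (2,0,0),(1,1,0),(0,2,0),(0,1,1) and a line L with trivalent subtree (24|13). *)

(* Defs.v *)
From HB Require Import structures.
From mathcomp Require Import all_boot all_order all_algebra.
From mathcomp Require Import all_classical reals.

Set Implicit Arguments.
Unset Strict Implicit.
Unset Printing Implicit Defensive.

Import Order.TTheory GRing.Theory Num.Theory.
Local Open Scope ring_scope.
Local Open Scope quotient_scope.
Local Open Scope classical_set_scope.

(* Tropical projective space. [TP R n] is R^n / R(1,...,1): the parameter is
   the number of homogeneous coordinates, so that [TP R n] is TP^(n-1). *)

Definition tp_rel (R : realType) (n : nat) : rel 'rV[R]_n :=
  fun u v => `[< exists t : R, u - v = const_mx t >].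

Lemma tp_rel_equiv (R : realType) (n : nat) : equiv_class_of (@tp_rel R n).
Proof.
split.
- by move=> u; apply/asboolP; exists 0; rewrite subrr; apply/rowP => i; rewrite !mxE.
- move=> u v; apply/asboolP/asboolP => -[t e]; exists (- t);
  by rewrite -opprB e; apply/rowP => i; rewrite !mxE.
- move=> v u w /asboolP[t e1] /asboolP[s e2]; apply/asboolP; exists (t + s).
  have -> : u - w = (u - v) + (v - w) by rewrite addrA subrK.
  by rewrite e1 e2; apply/rowP => i; rewrite !mxE.
Qed.

Canonical tp_equiv (R : realType) (n : nat) :=
  EquivRelPack (tp_rel_equiv R n).

Definition TP (R : realType) (n : nat) := {eq_quot (tp_equiv R n)}.

Definition tp_add (R : realType) (n : nat) (c : TP R n) (u : 'rV[R]_n) :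
  TP R n := \pi_(TP R n) (repr c + u).

Definition e_ (R : realType) (n : nat) (I : {set 'I_n}) : 'rV[R]_n :=
  \row_i (i \in I)%:R.

Definition dot (R : realType) (m : nat) (u v : 'rV[R]_m) : R :=
  \sum_k u 0 k * v 0 k.

(* The convex hull of the points [p i], [i \in S]. *)
Definition conv (R : realType) (m n : nat) (p : 'I_n -> 'rV[R]_m)
    (S : {set 'I_n}) : set 'rV[R]_m :=
  [set x | exists l : 'I_n -> R,
    [/\ forall i, 0 <= l i, forall i, i \notin S -> l i = 0,
        \sum_i l i = 1 & x = \sum_i l i *: p i]].

(* The face of Q on which the linear functional [dot w] is minimal. *)
Definition face (R : realType) (m : nat) (Q : set 'rV[R]_m) (w : 'rV[R]_m) :
    set 'rV[R]_m :=
  [set x | Q x /\ forall y, Q y -> dot w x <= dot w y].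

(* The dimension of the convex hull of the points [p i], [i \in S]. *)
Definition conv_dim (R : realType) (m n : nat) (p : 'I_n -> 'rV[R]_m)
    (S : {set 'I_n}) : nat :=
  \dim <<[seq p i - p j | i <- enum S, j <- enum S]>>%VS.

(* The segment from [p i] to [p j] is an edge of the convex hull of the point
   configuration [p k], [k \in S]: it lies on a one-dimensional face, and [p i]
   and [p j] are consecutive points of the configuration on that face. If no
   three of the points are collinear, this says that the segment is an edge of
   the polygon; in general a point that lies inside a side of the polygon
   subdivides this side, just as it does in a subdivision that uses it. The
   difference matters: for the points (2,0,0), (1,1,0), (0,2,0), (0,1,1), the
   side from a_1 to a_3 must not count as an edge, because no general
   configuration yields a tropical line with the subtree (24|13). *)
Definition is_edge (R : realType) (m n : nat) (p : 'I_n -> 'rV[R]_m)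
    (S : {set 'I_n}) (i j : 'I_n) : Prop :=
  (exists (w : 'rV[R]_m) (x y : 'I_n),
     [/\ x \in S, y \in S, p x <> p y,
         face (conv p S) w = conv p [set x; y]%SET &
         conv p [set i; j]%SET `<=` face (conv p S) w])
  /\ (forall k, k \in S -> conv p [set i; j]%SET (p k) -> k = i \/ k = j).

(* The exponent vectors, as points of R^3. *)
Definition pt (R : realType) (n : nat) (a : 'I_n -> 'rV[nat]_3) (i : 'I_n) :
  'rV[R]_3 := map_mx (fun k : nat => k%:R) (a i).

(* The term c_i + a_i . P. It depends on the representatives of c and P, but
   for exponents of constant degree another choice adds the same constant to
   all the terms. *)
Definition term (R : realType) (n : nat) (a : 'I_n -> 'rV[nat]_3)
    (c : TP R n) (P : TP R 3) (i : 'I_n) : R :=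
  repr c 0 i + dot (pt R a i) (repr P).

(* The indices in S at which the minimum of the terms in S is attained. *)
Definition min_terms (R : realType) (n : nat) (a : 'I_n -> 'rV[nat]_3)
    (S : {set 'I_n}) (c : TP R n) (P : TP R 3) : {set 'I_n} :=
  [set i in S | [forall j in S, term a c P i <= term a c P j]]%SET.

(* The tropical curve with support {a_i : i \in S}; the coefficients c_i with
   i \notin S are irrelevant. *)
Definition trop_curve (R : realType) (n : nat) (a : 'I_n -> 'rV[nat]_3)
    (S : {set 'I_n}) (c : TP R n) : set (TP R 3) :=
  [set P | (2 <= #|min_terms a S c P|)%N].

Definition general (R : realType) (n m : nat) (a : 'I_n -> 'rV[nat]_3)
    (C : 'I_m -> TP R 3) : Prop :=
  forall i j : 'I_n, i != j ->
    ~ exists c : TP R n, forall k, trop_curve a (~: [set i; j])%SET c (C k).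

Definition line_through (R : realType) (n m : nat) (a : 'I_n -> 'rV[nat]_3)
    (C : 'I_m -> TP R 3) : set (TP R n) :=
  [set c | forall k, trop_curve a [set: 'I_n]%SET c (C k)].

Definition lifted (R : realType) (n : nat) (a : 'I_n -> 'rV[nat]_3)
    (c : TP R n) (i : 'I_n) : 'rV[R]_(3 + 1) :=
  row_mx (pt R a i) (const_mx (repr c 0 i)).

(* Delta(c), as its set of cells: the projections of the lower faces, i.e. the
   faces selected by a functional with positive last coordinate. *)
Definition regular_subdivision (R : realType) (n : nat)
    (a : 'I_n -> 'rV[nat]_3) (c : TP R n) : set (set 'rV[R]_3) :=
  [set G | exists w : 'rV[R]_(3 + 1), 0 < w 0 (rshift 3 0) /\
     G = lsubmx @` face (conv (lifted a c) [set: 'I_n]%SET) w].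

(* Every cell is a simplex with vertices in A, and every point of A is a
   vertex. *)
Definition maximal_subdivision (R : realType) (n : nat)
    (a : 'I_n -> 'rV[nat]_3) (D : set (set 'rV[R]_3)) : Prop :=
  (forall G, D G -> exists S : {set 'I_n},
     G = conv (pt R a) S /\ #|S| = (conv_dim (pt R a) S).+1)
  /\ (forall i, D [set pt R a i]).

(* A finite metric graph with n labelled rays; ray i starts at [root i]. The
   orientation of the bounded edges is arbitrary. *)
Record ray_graph (R : realType) (n : nat) := RayGraph {
  vert : finType;
  edge : finType;
  src : edge -> vert;
  tgt : edge -> vert;
  len : edge -> R;
  root : 'I_n -> vert }.

(* Adjacency through the edges in D. *)
Definition adj (R : realType) (n : nat) (T : ray_graph R n)
    (D : {set edge T}) : rel (vert T) :=
  fun u v => [exists e in D,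
    ((src e == u) && (tgt e == v)) || ((src e == v) && (tgt e == u))].

Definition is_tree (R : realType) (n : nat) (T : ray_graph R n) : Prop :=
  (forall u v : vert T, connect (adj [set: edge T]%SET) u v)
  /\ (forall e : edge T, ~~ connect (adj [set~ e]%SET) (src e) (tgt e)).

Definition valence (R : realType) (n : nat) (T : ray_graph R n) (v : vert T) :
    nat :=
  (#|[set e : edge T | src e == v]%SET| + #|[set e : edge T | tgt e == v]%SET|
   + #|[set i : 'I_n | root T i == v]%SET|)%N.

(* The labels on the side of [tgt e] when the edge e is removed. *)
Definition side (R : realType) (n : nat) (T : ray_graph R n) (e : edge T) :
    {set 'I_n} :=
  [set i | connect (adj [set~ e]%SET) (tgt e) (root T i)]%SET.

(* The points of the metric graph: its vertices, the points in the interior of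
   a bounded edge, and the points of a ray other than its origin. *)
Inductive graph_point (R : realType) (n : nat) (T : ray_graph R n) : Type :=
| AtVert of vert T
| OnEdge of edge T & R
| OnRay of 'I_n & R.

Definition is_graph_point (R : realType) (n : nat) (T : ray_graph R n)
    (x : graph_point T) : Prop :=
  match x with
  | AtVert _ => True
  | OnEdge e t => 0 < t < len e
  | OnRay _ t => 0 < t
  end.

Definition embed (R : realType) (n : nat) (T : ray_graph R n)
    (pos : vert T -> TP R n) (x : graph_point T) : TP R n :=
  match x with
  | AtVert v => pos v
  | OnEdge e t => tp_add (pos (src e)) (t *: e_ R (side e))
  | OnRay i t => tp_add (pos (root T i)) (t *: e_ R [set i]%SET)
  end.

(* A tropical line. The direction of e towards [src e] is that of the
   complement of [side e], because e_I + e_(I^c) = (1,...,1). *)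
Record tropical_line (R : realType) (n : nat) := TropicalLine {
  graph :> ray_graph R n;
  pos : vert graph -> TP R n;
  line_tree : is_tree graph;
  line_len : forall e : edge graph, 0 < len e;
  line_valence : forall v : vert graph, (3 <= valence v)%N;
  line_direction : forall e : edge graph,
    pos (tgt e) = tp_add (pos (src e)) (len e *: e_ R (side e));
  line_embedded : forall x y : graph_point graph,
    is_graph_point x -> is_graph_point y -> embed pos x = embed pos y ->
    x = y }.

Definition points (R : realType) (n : nat) (L : tropical_line R n) :
    set (TP R n) :=
  embed (@pos R n L) @` [set x | is_graph_point x].

Definition trivalent (R : realType) (n : nat) (L : tropical_line R n) : Prop :=
  forall v : vert L, valence v = 3%N.

(* (ij|kl) is a trivalent subtree of L. *)
Definition trivalent_subtree (R : realType) (n : nat) (L : tropical_line R n)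
    (i j k l : 'I_n) : Prop :=
  uniq [:: i; j; k; l] /\
  exists e : edge L,
    ([set i; j] \subset side e)%SET && ([set k; l] \subset ~: side e)%SET
    || ([set k; l] \subset side e)%SET && ([set i; j] \subset ~: side e)%SET.

Definition compatible (R : realType) (n : nat) (a : 'I_n -> 'rV[nat]_3)
    (L : tropical_line R n) : Prop :=
  forall i j k l : 'I_n, trivalent_subtree L i j k l ->
    is_edge (pt R a) [set i; j; k; l]%SET i j \/
    is_edge (pt R a) [set i; j; k; l]%SET k l.

(* The leaves i and j lie in the same component of L \ {v}; a ray that starts
   at v is a component by itself. *)
Definition same_component (R : realType) (n : nat) (L : tropical_line R n)
    (v : vert L) (i j : 'I_n) : bool :=
  (i == j) ||
  [&& root L i != v, root L j != v &
      connect (fun x y => [&& adj [set: edge L]%SET x y, x != v & y != v])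
        (root L i) (root L j)].

(* P corresponds to a trivalent vertex of L. *)
Definition at_trivalent_vertex (R : realType) (n : nat)
    (a : 'I_n -> 'rV[nat]_3) (L : tropical_line R n) (P : TP R 3) : Prop :=
  exists (v : vert L) (i j k : 'I_n),
    [/\ valence v = 3%N,
        [/\ ~~ same_component v i j, ~~ same_component v i k &
            ~~ same_component v j k] &
        ([set i; j; k] \subset min_terms a [set: 'I_n] (pos v) P)%SET].

(* Main.v *)
Require Import Defs.
From mathcomp Require Import all_boot all_order all_algebra.
From mathcomp Require Import all_classical reals.
From mathcomp Require Import zify ring lra.

(** A vertex [v] of [L] splits the leaves into three classes, one for each
    edge or ray at [v]. The point of the configuration that belongs to [v] is
    a point [P_v] at which [min_m (v_m + a_m . P)] is attained by exactly
    three terms, one from each class; in the triangulation Delta(v) it is dual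
    to a triangle whose vertices lie in three different classes.

    Such a point exists by an argument of Sperner type, carried out in the
    plane of [P] instead of the triangulation ([tricolored_point]). The regions
    in which a given term is minimal are convex and cover the plane.
    Compatibility says that a segment between two exponents of a class and a
    segment between two exponents outside the class do not cross. If the union
    of the regions of a class were disconnected, the alternative of
    [crossing_below] would produce such a crossing, so each class and also the
    complement of each class is connected ([class_connected]). Suppose that no
    point is common to three regions of different classes I, J, K. Then
    [one of i, j is in I and the other one in J] is a cocycle modulo 2 on the
    nerve of the cover. A cover of a convex set by convex sets has no first
    cohomology ([cocycle_trivial]), so the cocycle is the coboundary of a
    function [phi], and [phi] is constant on I and on the complement of I.
    Therefore I cannot touch both J and K ([two_contacts]). The same holds for
    J and for K, but then one of the classes touches no other class, although
    the plane is connected. Maximality of Delta(v) is used twice: every term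
    is minimal somewhere, and no more than three terms are minimal at a point
    ([vertex_strict], [card_lows]).

    All the rest follows from one observation. If a point [c] of [L] lies
    beyond the edge or ray [g] of [v], then [c] arises from [v] by increasing
    exactly the coordinates in the class of [g] ([point_displaced]); so at
    [P_v] the minimum for [c] is attained precisely by the two terms of the
    triple that are not in this class ([min_displaced]). Hence every point of
    [L] is on the line through the configuration, and the points [P_v] are
    distinct. For the other two claims, compare an arbitrary [c] with a point
    [c0] of [L]: among the indices at which [c - c0] is least, the terms
    minimal at [P_v] for [c0] never occur alone ([another_nearest]). Since the
    two remaining terms at [P_v] tie together the classes of [v] that do not
    contain [c0], the set of these indices contains every class as a whole or
    not at all ([const_branch]). With [c0] on the ray [i], these classes are tied
    together to a single one, consisting of all leaves but [i]; for a curve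
    without the terms [i] and [j], the set would be nonempty and contain neither
    of them ([no_curve_missing_two]). With [c0] a vertex [v], the set is everything or
    the complement of one class, which means that [c] is [v] or lies in the
    direction of one edge or ray at [v] ([through_displaced]). A tree has fewer
    edges than vertices, so either some vertex points along a ray, or the two
    ends of an edge point towards each other, and [c] is on that ray or edge
    ([through_sub_line]). *)

Set Implicit Arguments.
Unset Strict Implicit.
Unset Printing Implicit Defensive.

Import Order.TTheory GRing.Theory Num.Theory.
Local Open Scope ring_scope.
Local Open Scope quotient_scope.

(** * Minimality regions of finitely many affine functions *)

Section Regions.
Variables (R : realFieldType) (V : lmodType R) (T : finType).
Variable l : T -> V -> R.
Hypothesis l_affine : forall m P Q t,
  l m (P + t *: (Q - P)) = l m P + t * (l m Q - l m P).

Implicit Types (S : {set T}) (i j k m : T) (P Q X : V).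

Definition lowest (S : {set T}) (i : T) (P : V) : Prop :=
  forall j, j \in S -> l i P <= l j P.

(** The regions of [i] and [j] meet: adjacency in the nerve of the cover by
    the regions of the indices in [S]. *)
Definition touch (S : {set T}) (i j : T) : Prop :=
  exists P, lowest S i P /\ lowest S j P.

Definition convex (Z : V -> Prop) : Prop :=
  forall P Q t, 0 <= t <= 1 -> Z P -> Z Q -> Z (P + t *: (Q - P)).

Lemma lowest_convex S i : convex (lowest S i).
Proof.
move=> P Q t /andP[t0 t1] hP hQ j jS; rewrite !l_affine.
have := hP j jS; have := hQ j jS; nra.
Qed.

Lemma lowest_sub (S S' : {set T}) i P :
  S \subset S' -> lowest S' i P -> lowest S i P.
Proof. by move=> /fintype.subsetP sub h j /sub; apply: h. Qed.

Lemma touch_sym S i j : touch S i j -> touch S j i.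
Proof. by case=> P [? ?]; exists P. Qed.

Lemma lowest_eq S i j P :
  i \in S -> j \in S -> lowest S i P -> lowest S j P -> l i P = l j P.
Proof. by move=> iS jS hi hj; apply/le_anti; rewrite hi // hj. Qed.

Lemma lowest_add S m i P : lowest S i P -> l i P <= l m P ->
  lowest (m |: S) i P.
Proof. by move=> h le j; rewrite !inE => /orP[/eqP->|/h]. Qed.

Lemma lowest_addm S m i P : i \in S -> lowest S i P -> l m P <= l i P ->
  lowest (m |: S) m P.
Proof.
move=> iS h le j; rewrite !inE => /orP[/eqP->//|/h]; exact: le_trans.
Qed.

Lemma exists_lowest (S : {set T}) i P :
  i \in S -> exists2 j, j \in S & lowest S j P.
Proof.
move=> iS; case: (arg_minP (fun j => l j P) iS) => j jS min.
by exists j => // k /min.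
Qed.

(** The intermediate value theorem, which for affine functions on a segment
    amounts to solving a linear equation. *)
Lemma level_crossing m i P Q : l m P <= l i P -> l i Q <= l m Q ->
  exists2 t, 0 <= t <= 1 &
    l m (P + t *: (Q - P)) = l i (P + t *: (Q - P)).
Proof.
move=> hP hQ; have [e|ne] := eqVneq (l m P) (l i P).
  by exists 0; rewrite ?lexx ?ler01 // scale0r addr0.
have lt : l m P < l i P by rewrite lt_neqAle ne.
have D : 0 < (l m Q - l i Q) + (l i P - l m P) by lra.
exists ((l i P - l m P) / ((l m Q - l i Q) + (l i P - l m P))).
  by rewrite divr_ge0 ?ler_pdivrMr //=; lra.
by rewrite !l_affine; field; rewrite gt_eqF.
Qed.

(** The step by which the nerve is controlled when an index [m] is added: on a
    segment that leaves the new region inside the region of [i] (or inside the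
    common region of [i] and [j]), the border of the new region is crossed. *)
Lemma pair_meets_new S m i j P Q :
  i \in S -> j \in S ->
  lowest S i P -> lowest S j P -> lowest S i Q -> lowest S j Q ->
  l m P <= l i P -> l i Q <= l m Q ->
  exists X, [/\ lowest (m |: S) i X, lowest (m |: S) j X &
                lowest (m |: S) m X].
Proof.
move=> iS jS iP jP iQ jQ mP mQ.
have [t t01 e] := level_crossing mP mQ.
have iX := lowest_convex t01 iP iQ; have jX := lowest_convex t01 jP jQ.
exists (P + t *: (Q - P)); split.
- by apply: lowest_add => //; rewrite e.
- by apply: lowest_add => //; rewrite e (lowest_eq iS jS iX jX).
- by apply: (lowest_addm iS iX); rewrite e.
Qed.

Lemma touches_new S m i P Q :
  i \in S -> lowest S i P -> l m P <= l i P -> lowest (m |: S) i Q ->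
  touch (m |: S) i m.
Proof.
move=> iS iP mP iQ; have iQ' := lowest_sub (finset.subsetUr _ _) iQ.
have mQ : l i Q <= l m Q by apply: iQ; rewrite finset.setU11.
by have [X [? _ ?]] := pair_meets_new iS iS iP iP iQ' iQ' mP mQ; exists X.
Qed.

(** A convex set is not a disjoint union of two nonempty sets that are closed
    unions of regions. The proof removes indices. One whose region misses [Z]
    can go without effect. Otherwise two regions that start to meet when [m] is
    removed met within the region of [m], so both of them met this region
    before, and [g] has the same value on them. *)
Lemma connected_cover (Z : V -> Prop) (S : {set T}) (g : T -> bool) :
  convex Z ->
  (forall i j P, i \in S -> j \in S -> Z P ->
     lowest S i P -> lowest S j P -> g i = g j) ->
  forall i j P Q, i \in S -> j \in S -> Z P -> Z Q ->
    lowest S i P -> lowest S j Q -> g i = g j.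
Proof.
move=> cZ; elim: {S}#|S| {-2}S (erefl #|S|) => [|N IH] S cS hg i j P Q iS jS.
  by move/eqP: cS; rewrite cards_eq0 => /eqP S0; rewrite S0 inE in iS.
move=> ZP ZQ iP jQ; have [->//|ij] := eqVneq i j.
have cS' m : m \in S -> #|S :\ m| = N.
  by move=> mS; move: cS; rewrite (cardsD1 m) mS => -[].
(* if only i and j are left, their regions meet on the segment from P to Q *)
have [[m [mS mi mj]]|no] :=
  pselect (exists m, [/\ m \in S, m != i & m != j]); last first.
  have SE k : k \in S -> k = i \/ k = j.
    move=> kS; have [->|ki] := eqVneq k i; first by left.
    have [->|kj] := eqVneq k j; first by right.
    by case: no; exists k.
  have [t t01 e] := level_crossing (iP j jS) (jQ i iS).
  apply: (hg i j (P + t *: (Q - P))) => //; first exact: cZ.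
    by move=> k /SE [] ->; rewrite ?e.
  by move=> k /SE [] ->; rewrite ?e.
have SmE m' : m' \in S -> m' |: (S :\ m') = S by exact: finset.setD1K.
have [[m' [m'S nX]]|allX] :=
  pselect (exists m', m' \in S /\ forall X, Z X -> ~ lowest S m' X).
  have low k X : k \in S :\ m' -> Z X -> lowest (S :\ m') k X -> lowest S k X.
    move=> kS ZX hk; rewrite -(SmE _ m'S); apply: lowest_add => //.
    rewrite leNgt; apply/negP => lt; apply: (nX X ZX); rewrite -(SmE _ m'S).
    by apply: lowest_addm kS hk _; apply: ltW.
  have m'i : i != m' by apply: contra_notN (nX P ZP) => /eqP <-.
  have m'j : j != m' by apply: contra_notN (nX Q ZQ) => /eqP <-.
  apply: (IH (S :\ m') (cS' _ m'S) _ i j P Q); rewrite ?inE ?iS ?jS ?m'i ?m'j //.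
  - move=> k k' X kS k'S ZX hk hk'; apply: (hg k k' X) => //; last 2 first.
      exact: low. exact: low.
    by move: kS; rewrite inE => /andP[]. by move: k'S; rewrite inE => /andP[].
  - exact: lowest_sub (finset.subsetDl _ _) iP.
  - exact: lowest_sub (finset.subsetDl _ _) jQ.
have reg k : k \in S -> exists2 X, Z X & lowest S k X.
  move=> kS; apply: contrapT => nX; apply: allX; exists k; split=> // X ZX hX.
  by apply: nX; exists X.
apply: (IH (S :\ m) (cS' _ mS) _ i j P Q);
  rewrite ?inE ?iS ?jS ?[i == m]eq_sym ?[j == m]eq_sym ?mi ?mj //; last 2 first.
- exact: lowest_sub (finset.subsetDl _ _) iP.
- exact: lowest_sub (finset.subsetDl _ _) jQ.
move=> k k' X kS k'S ZX hk hk'.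
have kS1 : k \in S by move: kS; rewrite inE => /andP[].
have k'S1 : k' \in S by move: k'S; rewrite inE => /andP[].
have kk' := lowest_eq kS k'S hk hk'.
have [le|/ltW le] := leP (l k X) (l m X).
  apply: (hg k k' X) => //; rewrite -(SmE _ mS); apply: lowest_add => //.
  by rewrite -kk'.
suff toM k0 : k0 \in S :\ m -> lowest (S :\ m) k0 X -> l m X <= l k0 X -> g k0 = g m.
  by rewrite (toM k) // (toM k') // -kk'.
move=> k0S hk0 le0; have k0S1 : k0 \in S by move: k0S; rewrite inE => /andP[].
have [Y ZY hY] := reg _ k0S1.
have hY' : lowest (S :\ m) k0 Y := lowest_sub (finset.subsetDl _ _) hY.
have [t t01 e] := level_crossing le0 (hY m mS).
have low := lowest_convex t01 hk0 hY'.
apply: (hg k0 m (X + t *: (Y - X))) => //; first exact: cZ.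
  by rewrite -(SmE _ mS); apply: lowest_add; rewrite ?e.
by rewrite -(SmE _ mS); apply: lowest_addm k0S low _; rewrite e.
Qed.

Hypothesis l_strict : forall i, exists P, forall j, j != i -> l i P < l j P.

(** A point where [i] is strictly minimal keeps the region of [i] nonempty in
    every subfamily; the lemmas on adding and removing indices rely on it. *)
Lemma has_region i : exists P, forall S, lowest S i P.
Proof.
have [P hP] := l_strict i; exists P => S j _.
by have [->//|/hP/ltW] := eqVneq j i.
Qed.

Lemma covered_touches S m i P : i \in S -> lowest S i P ->
  l m P <= l i P -> touch (m |: S) i m.
Proof.
move=> iS iP mP; have [Q iQ] := has_region i.
exact: touches_new iS iP mP (iQ _).
Qed.

Lemma covered_pair S m i j P : i \in S -> j \in S ->
  lowest S i P -> lowest S j P -> l m P <= l i P -> touch (m |: S) i j ->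
  exists X, [/\ lowest (m |: S) i X, lowest (m |: S) j X &
                lowest (m |: S) m X].
Proof.
move=> iS jS iP jP mP [Q [iQ jQ]].
have low k : lowest (m |: S) k Q -> lowest S k Q.
  exact: lowest_sub (finset.subsetUr _ _).
have mQ : l i Q <= l m Q by apply: iQ; rewrite finset.setU11.
exact: (pair_meets_new iS jS iP jP (low _ iQ) (low _ jQ) mP mQ).
Qed.

(** The first cohomology modulo 2 of the nerve of a convex cover vanishes. The
    induction removes an index [m]. The pairs that touch without [m] but not
    with [m] do so inside the region of [m], where the cocycle condition forces
    their value. The potential of the smaller family extends to [m] because the
    region of [m] is convex, hence connected. *)
Lemma cocycle_trivial (S : {set T}) (w : T -> T -> bool) :
  (forall i j k P, i \in S -> j \in S -> k \in S ->
     lowest S i P -> lowest S j P -> lowest S k P ->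
     w i j (+) w j k = w i k) ->
  exists phi : T -> bool, forall i j, i \in S -> j \in S -> touch S i j ->
    w i j = phi i (+) phi j.
Proof.
elim: {S}#|S| {-2}S (erefl #|S|) w => [|N IH] S cS w hw.
  move/eqP: cS; rewrite cards_eq0 => /eqP ->.
  by exists (fun=> false) => i j; rewrite inE.
have [m mS] : exists m, m \in S by apply/finset.set0Pn; rewrite -card_gt0 cS.
have cS' : #|S :\ m| = N by move: cS; rewrite (cardsD1 m) mS => -[].
move: hw; rewrite -(finset.setD1K mS).
move: (S :\ m) cS' => {cS mS}S cS hw.
have sub k : k \in S -> k \in m |: S by move=> ?; rewrite inE orbC; apply/orP; left.
have mm : m \in m |: S by rewrite finset.setU11.
have wii i P : i \in m |: S -> lowest (m |: S) i P -> w i i = false.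
  by move=> iS iP; have := hw i i i P iS iS iS iP iP iP; case: (w i i).
have wsym i j P : i \in m |: S -> j \in m |: S -> lowest (m |: S) i P ->
    lowest (m |: S) j P -> w i j = w j i.
  move=> iS jS iP jP; have := hw i j i P iS jS iS iP jP iP.
  by rewrite (wii i P) //; case: (w i j); case: (w j i).
have wS i j : i \in m |: S -> j \in m |: S -> touch (m |: S) i j -> w i j = w j i.
  by move=> iS jS [P [iP jP]]; apply: (wsym _ _ P).
(* removing m makes i and j touch inside the former region of m; there the
   cocycle condition dictates w i m (+) w m j *)
pose w' i j := if `[< touch (m |: S) i j >] then w i j else w i m (+) w m j.
have w'E i j P : i \in S -> j \in S -> lowest S i P -> lowest S j P ->
    l m P <= l i P -> w' i j = w i m (+) w m j.
  move=> iS jS iP jP mP; rewrite /w'; case: asboolP => // tij.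
  have [X [iX jX mX]] := covered_pair iS jS iP jP mP tij.
  by rewrite (hw _ _ _ X) //; exact: sub.
have hw' i j k P : i \in S -> j \in S -> k \in S ->
     lowest S i P -> lowest S j P -> lowest S k P -> w' i j (+) w' j k = w' i k.
  move=> iS jS kS iP jP kP.
  have ij := lowest_eq iS jS iP jP; have ik := lowest_eq iS kS iP kP.
  have [le|/ltW le] := leP (l i P) (l m P).
    have iP' : lowest (m |: S) i P by apply: lowest_add.
    have jP' : lowest (m |: S) j P by apply: lowest_add; rewrite -?ij.
    have kP' : lowest (m |: S) k P by apply: lowest_add; rewrite -?ik.
    rewrite /w' !asboolT; [|by exists P..].
    by apply: (hw i j k P) => //; exact: sub.
  rewrite !(w'E _ _ P) // -?ij // (wS m j) //; try exact: sub.
    by case: (w i m); case: (w j m); case: (w m k).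
  by apply: touch_sym; apply: (covered_touches jS jP); rewrite -ij.
have [phi hphi] := IH _ cS _ hw'.
have [->|[i0 i0S]] := finset.set_0Vmem S.
  exists (fun=> false) => i j; rewrite finset.setU0 !inE => /eqP-> /eqP-> _.
  have [P hP] := has_region m; exact: wii (hP _).
have gE (i j : T) P Q : i \in S -> j \in S -> lowest (m |: S) m P ->
    lowest (m |: S) m Q -> lowest S i P -> lowest S j Q ->
    phi i (+) w i m = phi j (+) w j m.
  move=> iS jS mP mQ iP jQ.
  apply: (@connected_cover (lowest (m |: S) m) S
            (fun i => phi i (+) w i m) _ _ i j P Q) => //.
    exact: lowest_convex.
  move=> k k' X kS k'S mX kX k'X; have mle := mX _ (sub _ kS).
  have := hphi k k' kS k'S; rewrite (w'E _ _ X) // (wS m k') //; last 2 first.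
    exact: sub.
    apply: touch_sym; apply: (covered_touches k'S k'X).
    by rewrite -(lowest_eq kS k'S kX k'X).
  move=> e; have /e : touch S k k' by exists X.
  by case: (phi k); case: (phi k'); case: (w k m); case: (w k' m).
have [Pm hPm] := has_region m.
have [im imS imP] := exists_lowest Pm i0S.
pose c := phi im (+) w im m.
have cE i : i \in S -> touch (m |: S) i m -> w i m = phi i (+) c.
  move=> iS [P [iP mP]]; rewrite /c -(gE i im P Pm) //; last first.
    exact: lowest_sub (finset.subsetUr _ _) iP.
  by case: (phi i); case: (w i m).
exists (fun i => if i == m then c else phi i) => i j.
rewrite !inE; have [->|im'] /= := eqVneq i m; have [->|jm'] //= := eqVneq j m.
- by move=> _ _ _; rewrite addbb; exact: wii (hPm _).
- by move=> _ jS /touch_sym t; rewrite -wS // ?cE 1?addbC //; exact: sub.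
- by move=> iS _ t; rewrite cE.
- move=> iS jS t; rewrite -hphi //; last first.
    by case: t => P [iP jP]; exists P; split; apply: (lowest_sub (finset.subsetUr [set m] S)).
  by rewrite /w' asboolT.
Qed.

(** Removing an index creates a contact only between two regions that both
    touched the removed one. *)
Lemma touch_remove S m i j : i \in S -> j \in S -> touch S i j ->
  touch (m |: S) i j \/ touch (m |: S) i m /\ touch (m |: S) j m.
Proof.
move=> iS jS [P [iP jP]]; have ij := lowest_eq iS jS iP jP.
have [le|/ltW le] := leP (l i P) (l m P).
  by left; exists P; split; apply: lowest_add; rewrite -?ij.
by right; split; apply: (covered_touches (P := P)) => //; rewrite -ij.
Qed.

(** Two unions of regions that do not touch remain apart when indices of these
    unions are removed, because a new contact would need a removed index that
    touches both sides. So it suffices to look at one index on either side. *)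
Lemma apart_restrict (I1 I2 B : {set T}) i j :
  i \in I1 -> j \in I2 ->
  (forall x, x \notin B -> x \in I1 \/ x \in I2) ->
  (forall x y, x \in I1 -> y \in I2 -> ~ touch [set: T]%SET x y) ->
  ~ touch ([set i; j]%SET :|: B) i j.
Proof.
move=> iI jI cover; set S0 := (_ :|: B).
suff H N S : (#|S| <= N)%N -> S0 \subset S ->
    (forall x y, x \in I1 -> y \in I2 -> x \in S -> y \in S -> ~ touch S x y) ->
    ~ touch S0 i j.
  by move=> h; apply: (H _ [set: T]%SET (leqnn _)) => [|x y ? ? _ _];
    [exact: finset.subsetT | exact: h].
have iS0 : i \in S0 by rewrite !inE eqxx.
have jS0 : j \in S0 by rewrite !inE eqxx orbT.
elim: N S => [|N IH] S cS sub h.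
  move: cS; rewrite leqn0 cards_eq0 => /eqP S0E.
  by move/fintype.subsetP: sub => /(_ i iS0); rewrite S0E inE.
have [SE|/eqP ne] := S =P S0.
  by rewrite -SE; apply: h => //; rewrite SE.
have : S0 \proper S by rewrite finset.properEneq eq_sym ne.
case/properP => _ [m mS mS0].
have mE : m |: (S :\ m) = S by exact: finset.setD1K.
apply: (IH (S :\ m)).
- by move: cS; rewrite (cardsD1 m) mS.
- by rewrite subsetD1 sub.
move=> x y xI yI xS yS /(touch_remove m xS yS); rewrite mE.
have xS' : x \in S by move: xS; rewrite inE => /andP[].
have yS' : y \in S by move: yS; rewrite inE => /andP[].
case=> [|[xm ym]]; first exact: h.
have mB : m \notin B by apply: contra mS0 => mB; rewrite inE mB orbT.
have [mI|mI] := cover m mB.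
- exact: (h m y mI yI mS yS' (touch_sym ym)).
- exact: (h x m xI mI xS' mS xm).
Qed.

End Regions.

(** * Convex hulls and an alternative for affine inequalities on a line *)

(** Helly's theorem on the line, in dual form: an infeasible system of affine
    inequalities in one variable contains two that contradict each other. *)
Lemma farkas1 (R : realFieldType) (T : finType) (B : {set T}) (al be : T -> R) :
  ~ (exists s, forall m, m \in B -> 0 <= al m + s * be m) ->
  exists k l mu, [/\ k \in B, l \in B, 0 <= mu <= 1,
    mu * be k + (1 - mu) * be l = 0 & mu * al k + (1 - mu) * al l < 0].
Proof.
move=> infeasible; apply: contrapT => none; apply: infeasible.
have zero m : m \in B -> be m = 0 -> 0 <= al m.
  move=> mB b0; rewrite leNgt; apply/negP => lt; apply: none.
  by exists m, m, 1; split; rewrite // ?ler01 ?lexx ?b0; lra.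
have pair k l : k \in B -> l \in B -> 0 < be k -> be l < 0 ->
    0 <= al l * be k - al k * be l.
  move=> kB lB bk bl; rewrite leNgt; apply/negP => lt; apply: none.
  have D : 0 < be k - be l by lra.
  (* the weights that cancel the two slopes *)
  exists k, l, (- be l / (be k - be l)); split=> //.
  - by rewrite divr_ge0 ?ler_pdivrMr //=; lra.
  - by field; rewrite gt_eqF.
  - have -> : - be l / (be k - be l) * al k + (1 - - be l / (be k - be l)) * al l
      = (al l * be k - al k * be l) / (be k - be l) by field; rewrite gt_eqF.
    by rewrite pmulr_llt0 // invr_gt0.
have [[k0 /andP[k0B k0p]]|nopos] := pselect (exists k, (k \in B) && (0 < be k)).
  case: (@arg_maxP _ _ T k0 (fun k => (k \in B) && (0 < be k))
           (fun k => - al k / be k)); first by rewrite k0B.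
  move=> k /andP[kB kp] max; exists (- al k / be k) => m mB.
  have [mp|mn|m0] := ltgtP 0 (be m).
  - have := max m; rewrite mB mp => /(_ isT); rewrite /= ler_pdivrMr //; lra.
  - have := pair k m kB mB kp mn.
    have -> : al m + - al k / be k * be m = (al m * be k - al k * be m) / be k.
      by field; rewrite gt_eqF.
    by move=> h; rewrite divr_ge0 // ltW.
  - by rewrite -m0 mulr0 addr0 zero.
have npos m : m \in B -> be m <= 0.
  by move=> mB; rewrite leNgt; apply/negP => p; apply: nopos; exists m; rewrite mB.
have [[k0 /andP[k0B k0n]]|noneg] := pselect (exists k, (k \in B) && (be k < 0)).
  case: (@arg_minP _ _ T k0 (fun k => (k \in B) && (be k < 0))
           (fun k => - al k / be k)); first by rewrite k0B.
  move=> k /andP[kB kn] min; exists (- al k / be k) => m mB.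
  have [m0|mn] := eqVneq (be m) 0; first by rewrite m0 mulr0 addr0 zero.
  have {}mn : be m < 0 by rewrite lt_neqAle mn npos.
  by have := min m; rewrite mB mn => /(_ isT); rewrite /= ler_ndivlMr //; lra.
exists 0 => m mB; rewrite mul0r addr0 zero //; apply/eqP.
rewrite eq_le npos //= leNgt; apply/negP => mn; apply: noneg.
by exists m; rewrite mB.
Qed.

Section Dot.
Variables (R : realType) (m : nat).
Implicit Types (u v w : 'rV[R]_m) (c : R).
Lemma dotC u v : dot u v = dot v u.
Proof. by apply: eq_bigr => k _; rewrite mulrC. Qed.
Lemma dotDl u v w : dot (u + v) w = dot u w + dot v w.
Proof. by rewrite -big_split; apply: eq_bigr => k _; rewrite mxE mulrDl. Qed.
Lemma dotZl c u w : dot (c *: u) w = c * dot u w.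
Proof. by rewrite mulr_sumr; apply: eq_bigr => k _; rewrite mxE mulrA. Qed.
Lemma dotDr u v w : dot w (u + v) = dot w u + dot w v.
Proof. by rewrite !(dotC w) dotDl. Qed.
Lemma dotZr c u w : dot w (c *: u) = c * dot w u.
Proof. by rewrite !(dotC w) dotZl. Qed.
Lemma dotBl u v w : dot (u - v) w = dot u w - dot v w.
Proof. by rewrite dotDl -scaleN1r dotZl mulN1r. Qed.
Lemma dotBr u v w : dot w (u - v) = dot w u - dot w v.
Proof. by rewrite !(dotC w) dotBl. Qed.
Lemma dot_suml (I : finType) (f : I -> 'rV[R]_m) w :
  dot (\sum_i f i) w = \sum_i dot (f i) w.
Proof.
by apply: (big_morph (fun u => dot u w)) => [u v|];
  rewrite ?dotDl // /dot big1 // => k _; rewrite mxE mul0r.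
Qed.
End Dot.

Section Conv.
Variables (R : realType) (m n : nat) (p : 'I_n -> 'rV[R]_m).
Implicit Types (i j k : 'I_n) (S : {set 'I_n}) (t : R).

Lemma sum_pair (V : lmodType R) (l : 'I_n -> R) (f : 'I_n -> V) i j : i != j ->
  (forall k, k != i -> k != j -> l k = 0) ->
  \sum_k l k *: f k = l i *: f i + l j *: f j.
Proof.
move=> ij l0; rewrite (bigD1 i) // (bigD1 j) 1?eq_sym //= addrA big1 ?addr0 //.
by move=> k /andP[ki kj]; rewrite l0 // scale0r.
Qed.

Lemma sum_pair1 (l : 'I_n -> R) i j : i != j ->
  (forall k, k != i -> k != j -> l k = 0) -> \sum_k l k = l i + l j.
Proof.
move=> ij l0; rewrite (bigD1 i) // (bigD1 j) 1?eq_sym //= addrA big1 ?addr0 //.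
by move=> k /andP[ki kj]; rewrite l0.
Qed.

Lemma in_conv2 i j t : i != j -> 0 <= t <= 1 ->
  conv p [set i; j]%SET ((1 - t) *: p i + t *: p j).
Proof.
move=> ij /andP[t0 t1].
pose l k : R := if k == i then 1 - t else if k == j then t else 0.
have li : l i = 1 - t by rewrite /l eqxx.
have lj : l j = t by rewrite /l eq_sym (negbTE ij) eqxx.
have l0 k : k != i -> k != j -> l k = 0 by rewrite /l => /negbTE-> /negbTE->.
exists l; split.
- by move=> k; rewrite /l; case: ifP => _; [|case: ifP => _] => //; lra.
- by move=> k; rewrite !inE negb_or => /andP[]; exact: l0.
- by rewrite (sum_pair1 ij l0) li lj subrK.
- by rewrite (sum_pair p ij l0) li lj.
Qed.

Lemma conv2P i j q : i != j -> conv p [set i; j]%SET q ->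
  exists2 t, 0 <= t <= 1 & q = (1 - t) *: p i + t *: p j.
Proof.
move=> ij [l [l0 lS l1 ->]].
have h k : k != i -> k != j -> l k = 0.
  by move=> ki kj; apply: lS; rewrite !inE negb_or ki.
move: l1; rewrite (sum_pair p ij h) (sum_pair1 ij h) => l1.
exists (l j); last by rewrite -l1 addrK.
by rewrite l0 -l1 lerDr l0.
Qed.

Lemma in_conv1 S i : i \in S -> conv p S (p i).
Proof.
move=> iS; exists (fun k => (k == i)%:R); split.
- by move=> k; rewrite ler0n.
- by move=> k; case: eqP => // ->; rewrite iS.
- by rewrite (bigD1 i) //= eqxx big1 ?addr0 // => k /negbTE->.
- rewrite (bigD1 i) //= eqxx scale1r big1 ?addr0 // => k /negbTE->.
  by rewrite scale0r.
Qed.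

Definition on_line i j (q : 'rV[R]_m) : Prop :=
  exists s, q = p i + s *: (p j - p i).

(** If the segment of [i, j] crosses that of [k, l] in a point other than [p i]
    and [p j], then a face that contains the latter segment contains [p i] and
    [p j] too; as the face is one-dimensional, the four points are collinear. *)
Lemma edge_collinear S i j k l t u :
  injective p -> is_edge p S k l -> i \in S -> j \in S -> i != j -> k != l ->
  0 < t < 1 -> 0 <= u <= 1 ->
  (1 - t) *: p i + t *: p j = (1 - u) *: p k + u *: p l ->
  on_line i j (p k) /\ on_line i j (p l).
Proof.
move=> injp [[w [x [y [xS yS pxy face_xy kl_face]]]] _] iS jS ij kl t01 u01 cross.
have xy : x != y by apply: contra_not_neq pxy => ->.
have fk : face (conv p S) w (p k).
  by apply: kl_face; apply: in_conv1; rewrite !inE eqxx.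
have fl : face (conv p S) w (p l).
  by apply: kl_face; apply: in_conv1; rewrite !inE eqxx orbT.
have fc : face (conv p S) w ((1 - t) *: p i + t *: p j).
  by rewrite cross; apply: kl_face; apply: in_conv2.
have [_ minc] := fc; rewrite dotDr !dotZr in minc.
have wi := minc _ (in_conv1 iS); have wj := minc _ (in_conv1 jS).
have Ei : dot w (p i) = dot w (p j) by nra.
have fi : face (conv p S) w (p i).
  by split; [exact: in_conv1 | move=> z /minc; rewrite -Ei; lra].
have fj : face (conv p S) w (p j).
  by split; [exact: in_conv1 | move=> z /minc; rewrite -Ei; lra].
rewrite face_xy in fi fj fk fl.
have [ti _ Hi] := conv2P xy fi; have [tj _ Hj] := conv2P xy fj.
have [tk _ Hk] := conv2P xy fk; have [tl _ Hl] := conv2P xy fl.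
have tij : tj - ti != 0.
  rewrite subr_eq0; apply: contra_neq ij => e; apply: injp.
  by rewrite Hi Hj e.
split; [exists ((tk - ti) / (tj - ti))|exists ((tl - ti) / (tj - ti))];
  rewrite ?Hi ?Hj ?Hk ?Hl; apply/rowP => c; rewrite !mxE; by field.
Qed.

End Conv.

(** * Three classes of exponents meet at a point *)

(** The term of index [i] for representatives [v] and [P] of points of the
    tropical projective spaces. *)
Definition height (R : realType) (n : nat) (a : 'I_n -> 'rV[nat]_3)
  (v : 'rV[R]_n) (i : 'I_n) (P : 'rV[R]_3) : R := v 0 i + dot (pt R a i) P.

Section Heights.
Variables (R : realType) (n : nat) (d : nat) (a : 'I_n -> 'rV[nat]_3).
Variable v : 'rV[R]_n.
Hypothesis injpt : injective (pt R a).
Hypothesis hom : forall i, (\sum_k a i ord0 k)%N = d.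
Hypothesis planar : conv_dim (pt R a) [set: 'I_n]%SET = 2%N.
Notation p := (pt R a).
Notation h := (height a v).
Hypothesis strict : forall i, exists P, forall j, j != i -> h i P < h j P.

Notation T := [set: 'I_n]%SET.
Implicit Types (i j k l : 'I_n) (B I J K : {set 'I_n}).

Lemma height_affine i P Q t :
  h i (P + t *: (Q - P)) = h i P + t * (h i Q - h i P).
Proof. by rewrite /height dotDr dotZr dotBr; ring. Qed.

(** An exponent that is a vertex of the subdivision lies strictly below every
    other lifted point over it: evaluate at a point where its term is the only
    minimal one. *)
Lemma strict_comb i x y z (s t u : R) :
  x != i -> y != i -> z != i -> 0 <= s -> 0 <= t -> 0 <= u -> s + t + u = 1 ->
  p i = s *: p x + t *: p y + u *: p z ->
  v 0 i < s * v 0 x + t * v 0 y + u * v 0 z.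
Proof.
move=> xi yi zi s0 t0 u0 stu e; have [P hP] := strict i.
have := hP _ xi; have := hP _ yi; have := hP _ zi.
rewrite /height e !dotDl !dotZl.
set X := dot (p x) P; set Y := dot (p y) P; set Z := dot (p z) P.
set D := s * X + t * Y + u * Z => hz hy hx.
have : 0 < s * (v 0 x + X - (v 0 i + D)) + t * (v 0 y + Y - (v 0 i + D))
         + u * (v 0 z + Z - (v 0 i + D)).
  have [s1|s1] := ltP 0 s; first by
    rewrite -addrA ltr_wpDr ?mulr_gt0 ?subr_gt0 ?addr_ge0 ?mulr_ge0 // subr_ge0 ltW.
  have [t1|t1] := ltP 0 t; first by
    rewrite addrAC ltr_wpDl ?mulr_gt0 ?subr_gt0 ?addr_ge0 ?mulr_ge0 // subr_ge0 ltW.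
  have u1 : 0 < u by lra.
  by rewrite ltr_wpDl ?mulr_gt0 ?subr_gt0 ?addr_ge0 ?mulr_ge0 // subr_ge0 ltW.
rewrite [X in 0 < X](_ : _ = s * v 0 x + t * v 0 y + u * v 0 z - v 0 i) ?subr_gt0 //.
by rewrite /D (_ : u = 1 - s - t); [ring | lra].
Qed.

Lemma dot_const (x : R) i : dot (p i) (const_mx x) = d%:R * x.
Proof.
rewrite /dot -(hom i) natr_sum mulr_suml.
by apply: eq_bigr => k _; rewrite !mxE.
Qed.

Lemma pt_sum i : p i 0 0 + p i 0 1 + p i 0 2%:R = d%:R.
Proof.
have := dot_const 1 i; rewrite /dot mulr1 => <-.
rewrite big_ord_recl big_ord_recl big_ord_recl big_ord0 !mxE !mulr1 addr0 addrA.
by congr (_ + _ + _); congr (a _ _ _)%:R; apply: val_inj.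
Qed.

Lemma dot3 (x y : 'rV[R]_3) :
  dot x y = x 0 0 * y 0 0 + x 0 1 * y 0 1 + x 0 2%:R * y 0 2%:R.
Proof.
rewrite /dot big_ord_recl big_ord_recl big_ord_recl big_ord0 addr0 addrA.
by congr (_ * _ + _ * _ + _ * _); congr (_ _ _); apply: val_inj.
Qed.

Lemma row3P (x y : 'rV[R]_3) :
  x 0 0 = y 0 0 -> x 0 1 = y 0 1 -> x 0 2%:R = y 0 2%:R -> x = y.
Proof.
move=> e0 e1 e2; apply/rowP => -[[|[|[|//]]] lt].
- by rewrite (_ : Ordinal lt = 0) //; apply: val_inj.
- by rewrite (_ : Ordinal lt = 1) //; apply: val_inj.
- by rewrite (_ : Ordinal lt = 2%:R) //; apply: val_inj.
Qed.

(** If the regions of [i] and [j] do not touch, then on the line of points where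
    the terms [i] and [j] agree some other term is always smaller. Two terms
    suffice for this by [farkas1], and the multipliers there describe a
    crossing of the segments, at which the lifted segment of [k, l] is lower.
    The crossing is in the interior of the segment of [i, j], as otherwise [i]
    or [j] would not be a vertex. *)
Lemma crossing_below i j B : i != j -> i \notin B -> j \notin B ->
  ~ touch h ([set i; j]%SET :|: B) i j ->
  exists k l u t, [/\ k \in B, l \in B, 0 <= u <= 1, 0 < t < 1 &
    (1 - t) *: p i + t *: p j = (1 - u) *: p k + u *: p l /\
    (1 - u) * v 0 k + u * v 0 l < (1 - t) * v 0 i + t * v 0 j].
Proof.
move=> ij iB jB apart.
pose e : 'rV[R]_3 := p j - p i.
have e_sum : e 0 0 + e 0 1 + e 0 2%:R = 0.
  by rewrite !mxE; have := pt_sum i; have := pt_sum j; rewrite !mxE; lra.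
have e0 : 0 < dot e e.
  have : e != 0 by rewrite subr_eq0; apply: contra_neq ij => /injpt.
  rewrite dot3; apply: contra_neqT; rewrite -leNgt => le0.
  have [x0 x1] : e 0 0 = 0 /\ e 0 1 = 0 by split; nra.
  have x2 : e 0 2%:R = 0 by nra.
  by apply: row3P; rewrite ?x0 ?x1 ?x2 [RHS]mxE.
(* the terms i and j agree on the line through P0 with direction nrm, which is
   the cross product of e and (1,1,1) *)
pose nrm : 'rV[R]_3 := \row_k (if k == 0 then e 0 1 - e 0 2%:R
  else if k == 1 then e 0 2%:R - e 0 0 else e 0 0 - e 0 1).
pose P0 : 'rV[R]_3 := ((v 0 i - v 0 j) / dot e e) *: e.
have nE (x : 'rV[R]_3) : dot x nrm = x 0 0 * (e 0 1 - e 0 2%:R)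
    + x 0 1 * (e 0 2%:R - e 0 0) + x 0 2%:R * (e 0 0 - e 0 1).
  by rewrite dot3 !mxE.
have level s : h j (P0 + s *: nrm) = h i (P0 + s *: nrm).
  suff : dot (p j - p i) (P0 + s *: nrm) = v 0 i - v 0 j.
    by rewrite /height dotBl; lra.
  rewrite dotDr !dotZr nE -/e -mulrA mulVf ?gt_eqF // mulr1; ring.
pose al m := h m P0 - h i P0; pose be m := dot (p m - p i) nrm.
have hE m s : h m (P0 + s *: nrm) - h i (P0 + s *: nrm) = al m + s * be m.
  by rewrite /al /be /height !dotDr !dotZr dotBl; ring.
have [|k [l [mu [kB lB mu01 be0 al0]]]] := @farkas1 R _ B al be.
  case=> s feas; apply: apart; exists (P0 + s *: nrm).
  have low : lowest h ([set i; j]%SET :|: B) i (P0 + s *: nrm).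
    move=> m; rewrite !inE -orbA => /or3P[/eqP->//|/eqP->|/feas].
      by rewrite level.
    by rewrite -hE subr_ge0.
  by split=> // m /low; rewrite level.
pose q : 'rV[R]_3 := mu *: p k + (1 - mu) *: p l - p i.
have q_sum : q 0 0 + q 0 1 + q 0 2%:R = 0.
  by rewrite !mxE; have := pt_sum i; have := pt_sum k; have := pt_sum l;
    rewrite !mxE; nra.
have q_n : dot q nrm = 0.
  by rewrite -be0 /be /q !dotBl !dotDl !dotZl; ring.
(* q is orthogonal to nrm and to (1,1,1), hence a multiple of e *)
have q_e : q 0 0 * e 0 1 = q 0 1 * e 0 0.
  move: q_n; rewrite nE.
  have -> : q 0 2%:R = - q 0 0 - q 0 1 by lra.
  have -> : e 0 2%:R = - e 0 0 - e 0 1 by lra.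
  by lra.
pose t := dot q e / dot e e.
have qt : q = t *: e.
  have E (c : 'I_3) : dot e e * q 0 c = dot q e * e 0 c -> q 0 c = (t *: e) 0 c.
    by move=> E; rewrite [RHS]mxE /t mulrAC -E mulrAC mulfV ?gt_eqF // mul1r.
  have q2 : q 0 2%:R = - q 0 0 - q 0 1 by lra.
  have e2 : e 0 2%:R = - e 0 0 - e 0 1 by lra.
  apply: row3P; apply: E; rewrite !dot3 ?q2 ?e2.
  - have : q 0 0 * e 0 1 * (e 0 1 + (e 0 0 + e 0 1)) =
      q 0 1 * e 0 0 * (e 0 1 + (e 0 0 + e 0 1)) by rewrite q_e.
    by lra.
  - have : q 0 0 * e 0 1 * (e 0 0 + (e 0 0 + e 0 1)) =
      q 0 1 * e 0 0 * (e 0 0 + (e 0 0 + e 0 1)) by rewrite q_e.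
    by lra.
  - have : q 0 0 * e 0 1 * (e 0 1 - e 0 0) = q 0 1 * e 0 0 * (e 0 1 - e 0 0) by rewrite q_e.
    by lra.
clearbody t.
have cross : (1 - t) *: p i + t *: p j = mu *: p k + (1 - mu) *: p l.
  have -> : mu *: p k + (1 - mu) *: p l = p i + q by rewrite /q [RHS]addrC subrK.
  by rewrite qt; apply/rowP => c; rewrite !mxE; ring.
have below : mu * v 0 k + (1 - mu) * v 0 l < (1 - t) * v 0 i + t * v 0 j.
  have := al0; rewrite /al.
  have := congr1 (fun x => dot x P0) cross; rewrite !dotDl !dotZl.
  have := level 0; rewrite scale0r addr0 /height; nra.
have [ki li] : k != i /\ l != i.
  by split; apply: contraNneq iB => <-.
have [kj lj] : k != j /\ l != j.
  by split; apply: contraNneq jB => <-.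
have [mu0 mu1] := andP mu01.
exists k, l, (1 - mu), t; rewrite (_ : 1 - (1 - mu) = mu); last ring.
split=> //; first by rewrite subr_ge0 lerBlDr lerDl mu1.
have [t0|t0] /= := leP t 0.
  suff : v 0 i < mu / (1 - t) * v 0 k + (1 - mu) / (1 - t) * v 0 l + - t / (1 - t) * v 0 j.
    rewrite -(ltr_pM2l (_ : 0 < 1 - t)); last lra.
    rewrite [X in _ < X](_ : _ = mu * v 0 k + (1 - mu) * v 0 l - t * v 0 j); last by field; lra.
    lra.
  have T : 0 < 1 - t by lra.
  have T1 : t <= 1 by lra.
  have ji : j != i by rewrite eq_sym.
  apply: (strict_comb ki li ji); rewrite ?divr_ge0 ?subr_ge0 ?oppr_ge0 ?(ltW T) //.
    by field; rewrite gt_eqF.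
  rewrite (_ : p i = (1 - t)^-1 *: (mu *: p k + (1 - mu) *: p l - t *: p j)); last first.
    by rewrite -cross addrK scalerA mulVf ?scale1r // gt_eqF.
  by apply/rowP => c; rewrite !mxE; field; rewrite gt_eqF.
rewrite ltNge; apply/negP => t1.
suff : v 0 j < mu / t * v 0 k + (1 - mu) / t * v 0 l + (t - 1) / t * v 0 i.
  rewrite -(ltr_pM2l t0).
  rewrite [X in _ < X](_ : _ = mu * v 0 k + (1 - mu) * v 0 l + (t - 1) * v 0 i);
    last by field; rewrite gt_eqF.
  lra.
apply: (strict_comb kj lj ij); rewrite ?divr_ge0 ?subr_ge0 ?(ltW t0) //.
  by field; rewrite gt_eqF.
rewrite (_ : p j = t^-1 *: (mu *: p k + (1 - mu) *: p l + (t - 1) *: p i)); last first.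
  by rewrite -cross; apply/rowP => c; rewrite !mxE; field; rewrite gt_eqF.
by apply/rowP => c; rewrite !mxE; field; rewrite gt_eqF.
Qed.

(** What compatibility yields for the two sides [I] and [J] of an edge. *)
Definition separated I J : Prop := forall i i' k l,
  i \in I -> i' \in I -> i != i' -> k \in J -> l \in J -> k != l ->
  is_edge p [set i; i'; k; l]%SET i i' \/ is_edge p [set i; i'; k; l]%SET k l.

Lemma separated_sym I J : separated I J -> separated J I.
Proof.
move=> sep i i' k l iI i'I ii' kJ lJ kl.
have -> : [set i; i'; k; l]%SET = [set k; l; i; i']%SET.
  by apply/finset.setP => x; rewrite !inE; case: (x == i); case: (x == i');
    case: (x == k); case: (x == l).
by case: (sep k l i i'); [..|right|left].
Qed.

(** An exponent [k] of [B] strictly between [i] and [j] is only possible if all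
    of [B] is on the same line: the segment of [i, j] is not an edge in the
    presence of [k], so for any other [b] the segment from [k] to [b] is one,
    and the face that contains it contains [i] and [j]. *)
Lemma between_on_line I B i j k b t :
  separated I B -> (forall x, x \in I -> x \notin B) -> i \in I -> j \in I ->
  i != j -> k \in B -> 0 < t < 1 -> p k = (1 - t) *: p i + t *: p j ->
  b \in B -> on_line p i j (p b).
Proof.
move=> sep dis iI jI ij kB t01 pk bB.
have kI x : x \in I -> k <> x by move=> /dis + kx; rewrite -kx kB.
have [->|bk] := eqVneq b k.
  by exists t; rewrite pk; apply/rowP => c; rewrite !mxE; ring.
have kb : k != b by rewrite eq_sym.
have [[_ cons]|kb_edge] := sep i j k b iI jI ij kB bB kb.
  have kS : k \in [set i; j; k; b]%SET by rewrite !inE eqxx ?orbT.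
  case: (cons k kS) => [|/(kI _ iI)//|/(kI _ jI)//].
  by rewrite pk; apply: in_conv2 => //; case/andP: t01 => *; rewrite !ltW.
have u01 : 0 <= (0 : R) <= 1 by rewrite lexx ler01.
have [] := @edge_collinear _ _ _ p [set i; j; k; b]%SET i j k b t 0 injpt kb_edge
  _ _ ij kb t01 u01; rewrite ?inE ?eqxx ?orbT //.
by rewrite -pk subr0 scale1r scale0r addr0.
Qed.

Lemma on_line_swap i j k l : i != j -> on_line p k l (p i) -> on_line p k l (p j) ->
  on_line p i j (p k) /\ on_line p i j (p l).
Proof.
move=> ij [s ps] [r pr].
have rs : r - s != 0.
  rewrite subr_eq0; apply: contra_neq ij => e; apply: injpt.
  by rewrite ps pr e.
split; [exists (- s / (r - s)) | exists ((1 - s) / (r - s))];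
  by rewrite ps pr; apply/rowP => c; rewrite !mxE; field.
Qed.

(** A crossing contradicts [separated] unless all four points are collinear; and
    then, since the segment of [k, l] is the lower one, [k] or [l] lies between
    [i] and [j]. *)
Lemma crossing_on_line I B i j k l u t b :
  separated I B -> (forall x, x \in I -> x \notin B) -> i \in I -> j \in I ->
  i != j -> k \in B -> l \in B -> 0 <= u <= 1 -> 0 < t < 1 ->
  (1 - t) *: p i + t *: p j = (1 - u) *: p k + u *: p l ->
  (1 - u) * v 0 k + u * v 0 l < (1 - t) * v 0 i + t * v 0 j ->
  b \in B -> on_line p i j (p b).
Proof.
move=> sep dis iI jI ij kB lB u01 t01 cross below bB.
have via x : x \in B -> p x = (1 - t) *: p i + t *: p j -> on_line p i j (p b).
  by move=> xB px; exact: (between_on_line sep dis iI jI ij xB t01 px bB).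
have [kl|kl] := eqVneq k l.
  by apply: (via k) => //; rewrite cross kl -scalerDl subrK scale1r.
have [u0|un0] := eqVneq u 0.
  by apply: (via k) => //; rewrite cross u0 subr0 scale1r scale0r addr0.
have [u1|un1] := eqVneq u 1.
  by apply: (via l) => //; rewrite cross u1 subrr scale1r scale0r add0r.
have u01' : 0 < u < 1.
  by case/andP: u01 => ? ?; rewrite lt_neqAle eq_sym un0 /= lt_neqAle un1; apply/andP.
have t01' : 0 <= t <= 1 by case/andP: t01 => *; rewrite !ltW.
have [[al pk] [be pl]] : on_line p i j (p k) /\ on_line p i j (p l).
  have [e|e] := sep i j k l iI jI ij kB lB kl; last first.
    by apply: (edge_collinear injpt e _ _ ij kl t01 u01 cross);
      rewrite !inE eqxx ?orbT.
  have [] := edge_collinear injpt e (i := k) (j := l) _ _ kl ij u01' t01' (esym cross);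
    rewrite ?inE ?eqxx ?orbT //.
  exact: on_line_swap.
have on x s : x \in B -> p x = p i + s *: (p j - p i) -> 0 < s < 1 ->
    on_line p i j (p b).
  move=> xB px s01; apply: (between_on_line sep dis iI jI ij xB s01 _ bB).
  by rewrite px; apply/rowP => c; rewrite !mxE; ring.
have [al01|al01] := boolP (0 < al < 1); first exact: (on k al).
have [be01|be01] := boolP (0 < be < 1); first exact: (on l be).
have ne x y : x \in B -> y \in I -> x != y.
  by move=> xB /dis; apply: contraNneq => <-.
(* neither k nor l lies between i and j, so i and j lie between k and l *)
have tE : t = (1 - u) * al + u * be.
  have ej : p j - p i != 0 by rewrite subr_eq0; apply: contra_neq ij => /injpt.
  apply/eqP; rewrite -subr_eq0; apply: contra_neqT ej => ne0.
  apply/(scalerI ne0); rewrite scaler0.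
  have := cross; rewrite pk pl => E.
  have -> : (t - ((1 - u) * al + u * be)) *: (p j - p i)
     = ((1 - t) *: p i + t *: p j) - ((1 - u) *: (p i + al *: (p j - p i))
       + u *: (p i + be *: (p j - p i))).
    by apply/rowP => c; rewrite !mxE; ring.
  by rewrite E subrr.
have outer x y s r w : x \in B -> y \in B -> 0 < w < 1 ->
    p x = p i + s *: (p j - p i) -> p y = p i + r *: (p j - p i) ->
    s <= 0 -> 1 <= r -> t = (1 - w) * s + w * r ->
    (1 - w) * v 0 x + w * v 0 y < (1 - t) * v 0 i + t * v 0 j -> False.
  move=> xB yB /andP[w0 w1] px py s0 r1 tw lt.
  have D : 0 < r - s by lra.
  have r0 : 0 <= r by lra.
  have sr : s <= r by lra.
  have s1 : s <= 1 by lra.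
  have ji : j != i by rewrite eq_sym.
  have hi : v 0 i < r / (r - s) * v 0 x + - s / (r - s) * v 0 y + 0 * v 0 j.
    apply: (strict_comb (ne _ _ xB iI) (ne _ _ yB iI) ji);
      rewrite ?divr_ge0 ?oppr_ge0 ?subr_ge0 ?lexx //.
      by field; rewrite gt_eqF.
    by rewrite px py; apply/rowP => c; rewrite !mxE; field; rewrite gt_eqF.
  have hj : v 0 j < (r - 1) / (r - s) * v 0 x + (1 - s) / (r - s) * v 0 y + 0 * v 0 i.
    apply: (strict_comb (ne _ _ xB jI) (ne _ _ yB jI) ij);
      rewrite ?divr_ge0 ?subr_ge0 ?lexx //.
      by field; rewrite gt_eqF.
    by rewrite px py; apply/rowP => c; rewrite !mxE; field; rewrite gt_eqF.
  have : (1 - t) * v 0 i + t * v 0 j <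
    (1 - t) * (r / (r - s) * v 0 x + - s / (r - s) * v 0 y + 0 * v 0 j)
    + t * ((r - 1) / (r - s) * v 0 x + (1 - s) / (r - s) * v 0 y + 0 * v 0 i).
    by case/andP: t01 => t0 t1; rewrite ltrD // ltr_pM2l // subr_gt0.
  rewrite [X in _ < X](_ : _ = (1 - w) * v 0 x + w * v 0 y); last first.
    by rewrite tw; field; rewrite gt_eqF.
  lra.
case/andP: u01' => u0 u1; case/andP: t01 => t0 t1.
move: al01 be01; rewrite !negb_and -!leNgt.
move=> /orP[a0|a1] /orP[b0|b1]; exfalso.
- by move: t0; rewrite tE; nra.
- by apply: (outer k l al be u) => //; rewrite u0.
- apply: (outer l k be al (1 - u)) => //; rewrite ?subr_gt0 ?u1 ?ltrBlDr ?ltrDl //.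
    by rewrite tE; ring.
  by move: below; rewrite (_ : 1 - (1 - u) = u); [rewrite addrC | ring].
- by move: t1; rewrite tE; nra.
Qed.

Lemma off_line i j : exists x, ~ on_line p i j (p x).
Proof.
apply: contrapT => none.
have all x : on_line p i j (p x).
  by apply: contrapT => nx; apply: none; exists x.
move: planar; suff : (conv_dim p [set: 'I_n]%SET <= 1)%N by move=> + e; rewrite e.
apply: leq_trans (_ : (\dim <[p j - p i]>%VS <= 1)%N); last first.
  by rewrite dim_vline; case: eqP.
apply: dimvS; apply/span_subvP => _ /allpairsP[[x y] [_ _ ->]] /=.
have [s ->] := all x; have [r ->] := all y.
rewrite opprD addrACA subrr add0r -scalerBl; apply: memvZ; exact: memv_line.
Qed.

(** If the class splits into two parts that do not touch, then every pair taken
    from both parts is crossed, so the exponents outside the class lie on the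
    line of each such pair. As the exponents are not collinear, some member of
    the class is off one of these lines, and the line that joins it to the other
    part meets the first line in an end point only, where no crossing can be. *)
Lemma class_connected I (g : 'I_n -> bool) :
  separated I (~: I)%SET ->
  (forall i j, i \in I -> j \in I -> touch h T i j -> g i = g j) ->
  forall i j, i \in I -> j \in I -> g i = g j.
Proof.
move=> sep inv i j iI jI; apply/eqP; apply: contraT => gij.
pose I1 := [set x in I | g x == g i]%SET.
pose I2 := [set x in I | g x != g i]%SET.
have apart x y : x \in I1 -> y \in I2 -> ~ touch h T x y.
  rewrite !inE => /andP[xI /eqP gx] /andP[yI gy] txy.
  by rewrite -gx (inv x y) ?eqxx in gy.
have cover x : x \notin (~: I)%SET -> x \in I1 \/ x \in I2.
  by rewrite !inE negbK => ->; case: eqP; [left|right].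
have dis x : x \in I -> x \notin (~: I)%SET by rewrite !inE => ->.
have sub1 x : x \in I1 -> x \in I by rewrite inE => /andP[].
have sub2 x : x \in I2 -> x \in I by rewrite inE => /andP[].
have ne x y : x \in I1 -> y \in I2 -> x != y.
  rewrite !inE => /andP[_ /eqP gx] /andP[_]; apply: contraNneq => <-.
  by rewrite gx.
have cross x y : x \in I1 -> y \in I2 ->
    exists k l u t, [/\ k \in (~: I)%SET, l \in (~: I)%SET, 0 <= u <= 1, 0 < t < 1 &
    (1 - t) *: p x + t *: p y = (1 - u) *: p k + u *: p l /\
    (1 - u) * v 0 k + u * v 0 l < (1 - t) * v 0 x + t * v 0 y].
  move=> x1 y2; apply: (crossing_below (ne _ _ x1 y2)).
  - exact/dis/sub1.
  - exact/dis/sub2.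
  - apply: (apart_restrict height_affine strict x1 y2 cover apart).
have i1 : i \in I1 by rewrite inE iI eqxx.
have j2 : j \in I2 by rewrite inE jI eq_sym.
have ij := ne _ _ i1 j2.
have [k [l [u [t [kB lB u01 t01 [cr lo]]]]]] := cross i j i1 j2.
have lineB b : b \in (~: I)%SET -> on_line p i j (p b).
  exact: (crossing_on_line sep dis iI jI ij kB lB u01 t01 cr lo).
(* x is off the line that contains all exponents outside I, so it is in I *)
have [x nx] := off_line i j.
have xI : x \in I by have := contra_notN (lineB x) nx; rewrite inE negbK.
have comb k' l' u' : k' \in (~: I)%SET -> l' \in (~: I)%SET ->
    on_line p i j ((1 - u') *: p k' + u' *: p l').
  move=> /lineB [s ->] /lineB [r ->]; exists ((1 - u') * s + u' * r).
  by apply/rowP => c; rewrite !mxE; ring.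
exfalso; apply: nx.
have [|x1|x2] := cover x; first exact: dis.
- have [k' [l' [u' [t' [kB' lB' _ /andP[t0 t1] [cr' _]]]]]] := cross x j x1 j2.
  have [s] := comb k' l' u' kB' lB'; rewrite -cr' => e.
  have T : 0 < 1 - t' by lra.
  exists ((s - t') / (1 - t')).
  have -> : p x = (1 - t')^-1 *: (((1 - t') *: p x + t' *: p j) - t' *: p j).
    by rewrite addrK scalerA mulVf ?scale1r // gt_eqF.
  by rewrite e; apply/rowP => c; rewrite !mxE; field; rewrite gt_eqF.
- have [k' [l' [u' [t' [kB' lB' _ /andP[t0 t1] [cr' _]]]]]] := cross i x i1 x2.
  have [s] := comb k' l' u' kB' lB'; rewrite -cr' => e.
  exists (s / t').
  have -> : p x = t'^-1 *: (((1 - t') *: p i + t' *: p x) - (1 - t') *: p i).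
    by rewrite addrC addKr scalerA mulVf ?scale1r // gt_eqF.
  by rewrite e; apply/rowP => c; rewrite !mxE; field; rewrite gt_eqF.
Qed.

Definition contact I J : Prop :=
  exists i j, [/\ i \in I, j \in J & touch h T i j].

Lemma contact_sym I J : contact I J -> contact J I.
Proof. by case=> i [j [iI jJ /touch_sym t]]; exists j, i. Qed.

Definition partition3 I J K : Prop := forall i,
  [\/ [/\ i \in I, i \notin J & i \notin K],
      [/\ i \notin I, i \in J & i \notin K] |
      [/\ i \notin I, i \notin J & i \in K]].

Definition tricolored I J K : Prop := exists P i j k,
  [/\ i \in I, j \in J, k \in K &
      [/\ lowest h T i P, lowest h T j P & lowest h T k P]].

(** Without a point common to the three classes, [w] below is a cocycle. Its
    potential is constant on [I] and on the complement of [I], both being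
    connected, so [w] has the same value for all contacts of [I]; but it is 1 on
    contacts with [J] and 0 on contacts with [K]. *)
Lemma two_contacts I J K : partition3 I J K -> separated I (~: I)%SET ->
  contact I J -> contact I K -> tricolored I J K.
Proof.
move=> part sep [i1 [j1 [i1I j1J t1]]] [i2 [k2 [i2I k2K t2]]].
apply: contrapT => no.
pose w i j := ((i \in I) && (j \in J)) || ((i \in J) && (j \in I)).
have none x y z P : x \in I -> y \in J -> z \in K ->
    lowest h T x P -> lowest h T y P -> lowest h T z P -> False.
  by move=> xI yJ zK xP yP zP; apply: no; exists P, x, y, z.
have cocycle x y z P : x \in T -> y \in T -> z \in T -> lowest h T x P ->
    lowest h T y P -> lowest h T z P -> w x y (+) w y z = w x z.
  move=> _ _ _ xP yP zP; rewrite /w.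
  by case: (part x) => -[x1 x2 x3]; case: (part y) => -[y1 y2 y3];
    case: (part z) => -[z1 z2 z3];
    rewrite ?x1 ?x2 ?y1 ?y2 ?z1 ?z2 ?(negbTE x1) ?(negbTE x2) ?(negbTE y1)
      ?(negbTE y2) ?(negbTE z1) ?(negbTE z2) //; exfalso;
    first [exact: (none x y z P) | exact: (none x z y P) | exact: (none y x z P)
          | exact: (none y z x P) | exact: (none z x y P) | exact: (none z y x P)].
have [phi hphi] := cocycle_trivial height_affine strict cocycle.
have flat x y : touch h T x y -> w x y = false -> phi x = phi y.
  move=> t; rewrite hphi ?inE //; by case: (phi x); case: (phi y).
have JI x : x \in J -> x \notin I by case: (part x) => -[] // ? /negbTE->.
have KI x : x \in K -> x \notin I by case: (part x) => -[] // ? ? /negbTE->.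
have KJ x : x \in K -> x \notin J by case: (part x) => -[] // ? ? /negbTE->.
have IJ x : x \in I -> x \notin J.
  by move=> xI; apply: contraL xI; exact: JI.
have phiI x y : x \in I -> y \in I -> phi x = phi y.
  apply: (class_connected sep) => i j iI jI t.
  by apply: flat => //; rewrite /w iI jI (negbTE (IJ _ iI)) (negbTE (IJ _ jI)).
have phiC x y : x \in (~: I)%SET -> y \in (~: I)%SET -> phi x = phi y.
  apply: class_connected.
    by rewrite finset.setCK; exact: separated_sym.
  move=> i j; rewrite !inE => /negbTE iI /negbTE jI t.
  by apply: flat => //; rewrite /w iI jI !andbF.
have e1 : phi i1 = phi i2 by apply: phiI.
have e2 : phi j1 = phi k2 by apply: phiC; rewrite inE; [exact: JI | exact: KI].
have := hphi i1 j1 (finset.in_setT _) (finset.in_setT _) t1.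
rewrite e1 e2 -(hphi i2 k2 (finset.in_setT _) (finset.in_setT _) t2).
by rewrite /w i1I j1J i2I (negbTE (KJ _ k2K)) (negbTE (IJ _ i2I)) /=.
Qed.

(** The plane is connected, so the regions of [I] meet those outside [I]. *)
Lemma some_contact I J K i j : partition3 I J K -> i \in I -> j \notin I ->
  contact I J \/ contact I K.
Proof.
move=> part iI jI; have [?|nJ] := pselect (contact I J); first by left.
have [?|nK] := pselect (contact I K); first by right.
exfalso; have [P iP] := has_region strict i; have [Q jQ] := has_region strict j.
have out x y X : x \in I -> lowest h T x X -> lowest h T y X -> y \in I.
  move=> xI xX yX; case: (part y) => -[] // _ y1 y2; exfalso.
    by apply: nJ; exists x, y; split=> //; exists X.
  by apply: nK; exists x, y; split=> //; exists X.
have : (i \in I) = (j \in I); last by rewrite iI (negbTE jI).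
apply: (@connected_cover _ _ _ h height_affine (fun=> True) T
          (fun x => x \in I) _ _ i j P Q) => // x y X _ _ _ xX yX.
apply/idP/idP => ?; [exact: (out x y X) | exact: (out y x X)].
Qed.

(** Each class has a contact, so among the three classes some class has contacts
    with both others. *)
Lemma tricolored_point I J K i j k : partition3 I J K ->
  separated I (~: I)%SET -> separated J (~: J)%SET ->
  separated K (~: K)%SET ->
  i \in I -> j \in J -> k \in K -> tricolored I J K.
Proof.
move=> part sI sJ sK iI jJ kK.
have partJ : partition3 J I K.
  by move=> x; case: (part x) => -[]; [constructor 2|constructor 1|constructor 3].
have partK : partition3 K I J.
  by move=> x; case: (part x) => -[]; [constructor 2|constructor 3|constructor 1].
have jI : j \notin I by case: (part j) => -[]; rewrite ?jJ.
have iJ : i \notin J by case: (part i) => -[]; rewrite ?iI.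
have iK : i \notin K by case: (part i) => -[]; rewrite ?iI.
have byI := two_contacts part sI.
have byJ : contact J I -> contact J K -> tricolored I J K.
  move=> c1 c2; have [P [y [x [z [? ? ? []]]]]] := two_contacts partJ sJ c1 c2.
  by exists P, x, y, z.
have byK : contact K I -> contact K J -> tricolored I J K.
  move=> c1 c2; have [P [z [x [y [? ? ? []]]]]] := two_contacts partK sK c1 c2.
  by exists P, x, y, z.
have [IJ|IK] := some_contact part iI jI.
  have [KI|KJ] := some_contact partK kK iK.
    by apply: byI => //; exact: contact_sym.
  by apply: byJ; exact: contact_sym.
have [JI|JK] := some_contact partJ jJ iJ.
  by apply: byI => //; exact: contact_sym.
by apply: byK; exact: contact_sym.
Qed.

End Heights.

(** * Cells of a maximal regular subdivision *)

Section Faces.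
Variables (R : realType) (m n : nat) (p : 'I_n -> 'rV[R]_m).

(** A linear functional is minimal on the hull of those generators at which it is
    least. *)
Lemma face_conv w : face (conv p [set: 'I_n]%SET) w =
  conv p [set i | [forall j, dot w (p i) <= dot w (p j)]]%SET.
Proof.
apply/seteqP; split=> x.
  case=> -[l [l0 _ l1 ->]] min; exists l; split=> // i.
  rewrite inE => /forallPn[j]; rewrite -ltNge => lt.
  pose M := \big[Order.min/dot w (p j)]_k dot w (p k).
  have Mle k : M <= dot w (p k) by rewrite /M; apply: bigmin_le_cond.
  have Mi : M < dot w (p i) by apply: le_lt_trans (Mle j) lt.
  have [k Mk] : exists k, dot w (p k) = M.
    have [k _ mink] := arg_minP (fun k => dot w (p k)) (erefl : xpredT j).
    exists k; apply/le_anti; rewrite Mle andbT.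
    rewrite /M; apply/bigmin_geP; split=> [|q _]; exact: mink.
  have : \sum_q l q * (dot w (p q) - M) <= 0.
    under eq_bigr do rewrite mulrBr; rewrite sumrB -mulr_suml l1 mul1r.
    have -> : \sum_q l q * dot w (p q) = dot w (\sum_q l q *: p q).
      by rewrite dotC dot_suml; apply: eq_bigr => q _; rewrite dotZl dotC.
    by rewrite subr_le0 -Mk; apply: min; apply: in_conv1; rewrite inE.
  have ge q : 0 <= l q * (dot w (p q) - M) by rewrite mulr_ge0 ?subr_ge0.
  move=> le; have /eqP : \sum_q l q * (dot w (p q) - M) = 0.
    by apply/le_anti; rewrite le sumr_ge0.
  rewrite psumr_eq0 // => /allP /(_ i (mem_index_enum _)) /=.
  by rewrite mulf_eq0 subr_eq0 (gt_eqF Mi) orbF => /eqP.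
case=> l [l0 lM l1 ->]; split; first by exists l; split=> // i; rewrite inE.
move=> y [l' [l'0 _ l'1 ->]].
have lin (f : 'I_n -> R) : dot w (\sum_i f i *: p i) = \sum_i f i * dot w (p i).
  by rewrite dotC dot_suml; apply: eq_bigr => i _; rewrite dotZl dotC.
have -> : dot w (\sum_i l i *: p i) = \sum_i \sum_j l i * l' j * dot w (p i).
  by rewrite lin; apply: eq_bigr => i _; rewrite -mulr_suml -mulr_sumr l'1 mulr1.
have -> : dot w (\sum_i l' i *: p i) = \sum_i \sum_j l i * l' j * dot w (p j).
  rewrite lin exchange_big; apply: eq_bigr => j _.
  by rewrite -mulr_suml -mulr_suml l1 mul1r.
apply: ler_sum => i _; apply: ler_sum => j _.
have [->|li] := eqVneq (l i) 0; first by rewrite !mul0r.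
rewrite ler_wpM2l ?mulr_ge0 //.
have : i \in [set i | [forall j, dot w (p i) <= dot w (p j)]]%SET.
  by apply: contraNT li => /lM ->.
by rewrite inE => /forallP.
Qed.

End Faces.

Section Maximal.
Variables (R : realType) (n : nat) (a : 'I_n -> 'rV[nat]_3) (c : TP R n).
Notation p := (pt R a).
Notation h := (height a (repr c)).
Notation Delta := (regular_subdivision a c).
Hypothesis injpt : injective p.
Implicit Types (i j : 'I_n).

Definition lows (P : 'rV[R]_3) : {set 'I_n} :=
  [set i | [forall j, h i P <= h j P]]%SET.

Lemma dot_lifted (w : 'rV[R]_(3 + 1)) i : dot w (lifted a c i) =
  dot (pt R a i) (lsubmx w) + w 0 (rshift 3 0) * repr c 0 i.
Proof.
rewrite /dot big_split_ord big_ord1; congr (_ + _).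
  by apply: eq_bigr => k _; rewrite row_mxEl [lsubmx _ _ _]mxE mulrC.
by rewrite row_mxEr mxE.
Qed.

Lemma dot_lifted_height (w : 'rV[R]_(3 + 1)) i : 0 < w 0 (rshift 3 0) -> dot w (lifted a c i) =
  w 0 (rshift 3 0) * h i ((w 0 (rshift 3 0))^-1 *: lsubmx w).
Proof.
move=> w0; rewrite dot_lifted /height dotZr mulrDr mulrA mulfV ?gt_eqF //.
by rewrite mul1r addrC.
Qed.

Lemma lsubmx_conv S : (lsubmx @` conv (lifted a c) S)%classic = conv p S.
Proof.
have proj (l : 'I_n -> R) :
    lsubmx (\sum_i l i *: lifted a c i) = \sum_i l i *: p i.
  by rewrite linear_sum; apply: eq_bigr => i _; rewrite linearZ /= row_mxKl.
apply/seteqP; split=> x.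
  by case=> _ [l [l0 lS l1 ->]] <-; exists l; split=> //; rewrite proj.
case=> l [l0 lS l1 ->]; exists (\sum_i l i *: lifted a c i); last exact: proj.
by exists l.
Qed.

(** Duality: a functional with positive last coordinate, scaled to have last
    coordinate 1, is a point [P], and it selects the terms minimal at [P]. *)
Lemma cellP G : Delta G <-> exists P, G = conv p (lows P).
Proof.
have E (w : 'rV[R]_(3 + 1)) : 0 < w 0 (rshift 3 0) ->
    (lsubmx @` face (conv (lifted a c) [set: 'I_n]%SET) w)%classic =
    conv p (lows ((w 0 (rshift 3 0))^-1 *: lsubmx w)).
  move=> w0; rewrite face_conv lsubmx_conv; congr conv; apply/finset.setP => i.
  rewrite !inE; apply: eq_forallb => j.
  by rewrite !dot_lifted_height // ler_pM2l.
split=> [[w [w0 ->]]|[P ->]]; first by eexists; exact: E.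
pose w : 'rV[R]_(3 + 1) := row_mx P (const_mx 1).
have w1 : w 0 (rshift 3 0) = 1 by rewrite row_mxEr mxE.
exists w; rewrite w1 ltr01; split=> //.
by rewrite E w1 ?ltr01 // row_mxKl invr1 scale1r.
Qed.

Lemma vertex_strict i : Delta [set p i]%classic ->
  exists P, forall j, j != i -> h i P < h j P.
Proof.
case/cellP => P E; exists P.
have sub j : j \in lows P -> j = i.
  move=> /(in_conv1 p); rewrite -E => e; exact: injpt.
have [j jP] : exists j, j \in lows P.
  have [j _] := @exists_lowest _ _ _ h [set: 'I_n]%SET i P (finset.in_setT _).
  by move=> hj; exists j; rewrite inE; apply/forallP => k; apply: hj; rewrite inE.
move: (jP); rewrite (sub j jP) inE => /forallP iP k ki.
rewrite lt_neqAle iP andbT; apply: contraNneq ki => e; apply/eqP/sub.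
by rewrite inE; apply/forallP => q; rewrite -e.
Qed.

Hypothesis planar : conv_dim p [set: 'I_n]%SET = 2%N.
Hypothesis maxD : maximal_subdivision a Delta.

(** A vertex of the subdivision is not a convex combination of other exponents
    whose terms do not exceed its own term at some point. *)
Lemma not_below_comb (X : {set 'I_n}) i P : conv p X (p i) -> i \notin X ->
  (forall x, x \in X -> h x P <= h i P) -> False.
Proof.
case=> l [l0 lX l1 e] iX le; have [_ /(_ i) /vertex_strict [Q hQ]] := maxD.
have comb P0 : \sum_j l j * (h j P0 - h i P0) =
    \sum_j l j * repr c 0 j - repr c 0 i.
  under eq_bigr do rewrite /height mulrBr mulrDr.
  rewrite sumrB -mulr_suml l1 mul1r big_split /= e dot_suml.
  by under [X in _ + X - _]eq_bigr do rewrite -dotZl; rewrite opprD addrACA subrr addr0.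
have le0 : \sum_j l j * (h j P - h i P) <= 0.
  apply: sumr_le0 => j _; have [jX|jX] := boolP (j \in X).
    by rewrite mulr_ge0_le0 // subr_le0 le.
  by rewrite lX // mul0r.
have ge0 j : 0 <= l j * (h j Q - h i Q).
  have [->|ji] := eqVneq j i; first by rewrite subrr mulr0.
  by rewrite mulr_ge0 // subr_ge0 ltW // hQ.
have /eqP : \sum_j l j * (h j Q - h i Q) = 0.
  by apply/le_anti; rewrite sumr_ge0 // andbT comb -(comb P).
rewrite psumr_eq0 // => /allP all0.
suff l_0 j : l j = 0 by move/eqP: l1; rewrite big1 // eq_sym oner_eq0.
have [->|ji] := eqVneq j i; first exact: lX.
have := all0 j (mem_index_enum _); rewrite mulf_eq0 => /orP[/eqP//|].
by rewrite subr_eq0 gt_eqF // hQ.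
Qed.

(** A cell is a simplex on some set [S] of exponents. By [not_below_comb] its
    minimal terms are exactly the members of [S]: each of the two sets generates
    the cell, and all the exponents are vertices. *)
Lemma card_lows P : (#|lows P| <= 3)%N.
Proof.
have [/(_ (conv p (lows P)))] := maxD; case.
  by apply/cellP; exists P.
move=> S [E cS] _.
have SM : S \subset lows P.
  apply/fintype.subsetP => s sS; apply: contraT => sM; exfalso.
  apply: (@not_below_comb (lows P) s P) => //; first by rewrite E; exact: in_conv1.
  by move=> x; rewrite inE => /forallP.
have MS : lows P \subset S.
  apply/fintype.subsetP => s sM; apply: contraT => sS; exfalso.
  apply: (@not_below_comb S s P) => //; first by rewrite -E; exact: in_conv1.
  by move=> x /(fintype.subsetP SM); rewrite inE => /forallP.
apply: leq_trans (subset_leq_card MS) _; rewrite cS ltnS -[leqRHS]planar.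
apply: dimvS; apply: sub_span => _ /allpairsP[[x y] [_ _ ->]] /=.
by apply/allpairsP; exists (x, y); rewrite !mem_enum !inE.
Qed.

End Maximal.

(** * Trees with labelled rays *)

Section Tree.
Variables (R : realType) (n : nat) (T : ray_graph R n).
Hypothesis tree : is_tree T.
Implicit Types (x y u v : vert T) (e f : edge T) (i j : 'I_n).

Lemma adj_sym (D : {set edge T}) x y : adj D x y = adj D y x.
Proof. by apply: eq_existsb => e; rewrite orbC. Qed.

Lemma connect_adj_sym (D : {set edge T}) : connect_sym (adj D).
Proof. by apply: sym_connect_sym => x y; exact: adj_sym. Qed.

Lemma adj_edge (D : {set edge T}) e : e \in D -> adj D (src e) (tgt e).
Proof. by move=> eD; apply/existsP; exists e; rewrite eD !eqxx. Qed.

(** A function that does not change along edges is constant. The facts about the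
    tree are proved by exhibiting such functions, without any use of paths. *)
Lemma edge_invariant (A : Type) (g : vert T -> A) :
  (forall e, g (src e) = g (tgt e)) -> forall x y, g x = g y.
Proof.
move=> inv x y; case: tree => /(_ x y) /connectP[p pth ->] _.
elim: p x pth => //= z p IH x /andP[/existsP[e /andP[_ xz]] /IH <-].
by case/orP: xz => /andP[/eqP<- /eqP<-].
Qed.

Definition beyond_tgt e x : bool := connect (adj [set~ e]%SET) (tgt e) x.
Notation chi := beyond_tgt.

Lemma chi_tgt e : chi e (tgt e) = true. Proof. exact: connect0. Qed.

Lemma chi_src e : chi e (src e) = false.
Proof. by apply/negbTE; case: tree => _ /(_ e); rewrite /chi connect_adj_sym. Qed.

Lemma chi_other e f : f != e -> chi e (src f) = chi e (tgt f).
Proof.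
move=> fe; have a : adj [set~ e]%SET (src f) (tgt f).
  by apply: adj_edge; rewrite !inE.
apply/idP/idP => h; apply: connect_trans h _; apply: connect1 => //.
by rewrite adj_sym.
Qed.

Definition inc x e : bool := (src e == x) || (tgt e == x).
Definition other_end e x : vert T := if src e == x then tgt e else src e.
Definition sep e x y : bool := chi e x != chi e y.

Lemma src_tgt e : src e != tgt e.
Proof. by apply: contraFneq (chi_src e) => ->; exact: chi_tgt. Qed.

Lemma inc_opp e x : inc x e -> inc (other_end e x) e.
Proof. by rewrite /inc /other_end; case: eqP; rewrite eqxx ?orbT. Qed.

Lemma chi_opp e x : inc x e -> chi e (other_end e x) = ~~ chi e x.
Proof.
rewrite /inc /other_end; case: eqP => [<- _|_ /= /eqP<-]; by rewrite chi_src chi_tgt.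
Qed.

Lemma chi_opp_other e f x : inc x e -> f != e -> chi f (other_end e x) = chi f x.
Proof.
move=> + fe; have ef : e != f by rewrite eq_sym.
by rewrite /inc /other_end; case: eqP => [<- _|_ /= /eqP<-]; rewrite chi_other.
Qed.

Lemma sepC e x y : sep e x y = sep e y x.
Proof. by rewrite /sep eq_sym. Qed.

Lemma sep_opp e x y : inc x e -> sep e y (other_end e x) = ~~ sep e y x.
Proof. by move=> xe; rewrite /sep chi_opp //; case: (chi e y); case: (chi e x). Qed.

Lemma inc_chi e x y : inc x e -> inc y e -> chi e x = chi e y -> x = y.
Proof.
rewrite /inc => /orP[]/eqP<- /orP[]/eqP<- //; by rewrite chi_src chi_tgt.
Qed.

(** The number of edges at [v] that separate [x] from [v] is the same for all
    [x] other than [v], namely 1, as one sees at a neighbour of [v]. It is set to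
    1 at [v] itself to obtain a function that is invariant along all edges. *)
Lemma direction_count v x : x != v ->
  #|[set e | inc v e && sep e x v]%SET| = 1%N.
Proof.
move=> xv; pose cnt x := if x == v then 1%N else #|[set e | inc v e && sep e x v]%SET|.
suff : cnt x = cnt v by rewrite /cnt (negbTE xv) eqxx.
have atv e y z : inc v e -> y = v -> z = other_end e v -> cnt y = cnt z.
  move=> ve -> ->; rewrite /cnt eqxx.
  have -> : (other_end e v == v) = false.
    by apply/eqP => E; have := chi_opp ve; rewrite E; case: chi.
  apply/esym/eqP/cards1P; exists e; apply/finset.setP => f; rewrite !inE.
  have [->|fe] := eqVneq f e; first by rewrite ve /sep chi_opp //; case: chi.
  by rewrite /sep chi_opp_other // eqxx andbF.
apply: edge_invariant => e.
have [sv|sv] := eqVneq (src e) v.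
  by apply: (atv e) => //; rewrite /inc /other_end -sv eqxx.
have [tv|tv] := eqVneq (tgt e) v.
  by apply/esym/(atv e) => //; rewrite /inc /other_end -?tv ?eqxx ?orbT // (negbTE (src_tgt e)).
rewrite /cnt (negbTE sv) (negbTE tv); apply: eq_card => f; rewrite !inE.
case vf : (inc v f) => //=; rewrite /sep chi_other //.
by apply: contraTneq vf => <-; rewrite /inc negb_or sv tv.
Qed.

Lemma direction v x : x != v -> exists2 e, inc v e & sep e x v.
Proof.
move=> /direction_count /eqP /cards1P[e E].
by have : e \in [set e]%SET by [rewrite inE]; rewrite -E inE => /andP[]; exists e.
Qed.

Lemma direction_uniq v x e f :
  inc v e -> sep e x v -> inc v f -> sep f x v -> e = f.
Proof.
move=> ve se vf sf; have xv : x != v by apply: contraNneq se => ->.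
have /eqP/cards1P[e0 E] := direction_count xv.
have : e \in [set e0]%SET by rewrite -E inE ve.
have : f \in [set e0]%SET by rewrite -E inE vf.
by rewrite !inE => /eqP-> /eqP->.
Qed.

(** The two splits given by different edges are compatible: one of the four
    intersections of their sides is empty. *)
Lemma no_crossing e f x : e != f ->
  chi e x = chi e (src f) \/ chi f x = chi f (src e).
Proof.
move=> ef; have fe : f != e by rewrite eq_sym.
suff : ((chi e x == chi e (src f)) || (chi f x == chi f (src e))).
  by case/orP => /eqP; [left|right].
pose ok y := (chi e y == chi e (src f)) || (chi f y == chi f (src e)).
rewrite -/(ok x) (@edge_invariant _ ok _ x (src e)) /ok ?eqxx ?orbT // => g.
have [->|ge] := eqVneq g e; first by rewrite -(chi_other ef) eqxx !orbT.
have [->|gf] := eqVneq g f; first by rewrite -(chi_other fe) eqxx.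
by rewrite !(chi_other (_ : g != _)).
Qed.

Lemma sep_nested u x y e f : inc u f -> sep f x u -> sep e x u -> sep e y u ->
  sep f y u.
Proof.
move=> uf; have [->//|ef] := eqVneq e f.
have eu : chi e u = chi e (src f).
  by case/orP: uf => /eqP<- //; rewrite chi_other // eq_sym.
rewrite /sep eu => fx ex ey.
have [|xf] := no_crossing x ef; first by move/eqP; rewrite (negbTE ex).
have [|yf] := no_crossing y ef; first by move/eqP; rewrite (negbTE ey).
by rewrite yf -xf.
Qed.

(** Every edge has one end that is separated from [x] by it, and every vertex but
    [x] is that end for exactly one edge. *)
Lemma card_edges x : #|vert T| = #|edge T|.+1.
Proof.
pose far e := if sep e (src e) x then src e else tgt e.
have far_inc e : inc (far e) e by rewrite /far /inc; case: ifP; rewrite eqxx ?orbT.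
have far_sep e : sep e x (far e).
  rewrite /far; case: ifP; rewrite sepC // /sep chi_src chi_tgt.
  by case: (chi e x).
have inj : injective far.
  move=> e f E; apply: (@direction_uniq (far e) x) => //; rewrite E //.
rewrite -cardsT -(card_imset _ inj) (_ : _ @: _ = [set~ x]%SET).
  rewrite (cardsD1 x [set: _]%SET) inE add1n; congr _.+1.
  by apply: eq_card => y; rewrite !inE andbT.
apply/finset.setP => y; rewrite !inE; apply/imsetP/idP => [[e _ ->]|yx].
  by apply: contraTneq (far_sep e) => ->; rewrite /sep eqxx.
have [|e ye se] := @direction y x; first by rewrite eq_sym.
exists e; rewrite ?inE //; apply: (inc_chi ye (far_inc e)).
have := far_sep e; move: se; rewrite /sep.
by case: (chi e x); case: (chi e y); case: (chi e (far e)).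
Qed.

(** The ways to leave a vertex: along a bounded edge or along a ray. *)
Definition germ : finType := (edge T + 'I_n)%type.
Implicit Types g : germ.

Definition germ_at v g : bool :=
  match g with inl e => inc v e | inr i => Defs.root T i == v end.

(** The class of leaves that one reaches from [v] along [g], if [g] is at [v]. *)
Definition beyond v g : {set 'I_n} :=
  match g with
  | inl e => [set i | sep e (Defs.root T i) v]%SET
  | inr i => [set i]%SET
  end.

Lemma germ_of v i : exists2 g, germ_at v g & i \in beyond v g.
Proof.
have [iv|iv] := eqVneq (Defs.root T i) v; first by exists (inr i); rewrite /= ?iv ?inE.
by have [e ve se] := direction iv; exists (inl e); rewrite /= ?inE.
Qed.

Lemma germ_uniq v i g g' : germ_at v g -> germ_at v g' ->
  i \in beyond v g -> i \in beyond v g' -> g = g'.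
Proof.
rewrite /germ_at /beyond; case: g => [e|j]; case: g' => [f|k]; rewrite !inE.
- by move=> ve vf se sf; rewrite (direction_uniq ve se vf sf).
- by move=> _ /eqP<- + /eqP ik; rewrite ik /sep eqxx.
- by move=> /eqP<- _ /eqP<-; rewrite /sep eqxx.
- by move=> _ _ /eqP<- /eqP<-.
Qed.

Lemma beyond_disjoint v g g' i : germ_at v g -> germ_at v g' -> g != g' ->
  i \in beyond v g' -> i \notin beyond v g.
Proof.
by move=> vg vg' gg' ig'; apply: contra gg' => ig; rewrite (germ_uniq vg vg' ig ig').
Qed.

Lemma valenceE v : valence v = #|[set g | germ_at v g]%SET|.
Proof.
rewrite -sum1dep_card big_sumType /= !sum1dep_card /valence; congr (_ + _)%N.
rewrite -[RHS](cardsID [set e | src e == v]%SET); congr (_ + _)%N;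
  apply: eq_card => e; rewrite !inE /inc.
  by case: (src e == v); rewrite ?andbF.
have := src_tgt e; have [->|_ _] //= := eqVneq (src e) v.
by rewrite eq_sym => /negbTE->.
Qed.

(** Counting the germs at all vertices gives [3 |V| = 2 |E| + n]. *)
Lemma card_vert : (0 < n)%N -> (forall v : vert T, valence v = 3%N) -> #|vert T| = (n - 2)%N.
Proof.
move=> n0 val3; have VE := card_edges (Defs.root T (Ordinal n0)).
have : (\sum_(v : vert T) valence v = #|edge T| + #|edge T| + n)%N.
  have fib (A : finType) (f : A -> vert T) :
      (\sum_(v : vert T) #|[set a | f a == v]%SET| = #|A|)%N.
    rewrite -sum1_card (partition_big f xpredT) //=; apply: eq_bigr => v _.
    by rewrite sum1dep_card.
  by rewrite /valence !big_split /= !fib card_ord.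
under eq_bigr do rewrite val3.
rewrite sum_nat_const VE => H; move: H; generalize #|edge T| => E; lia.
Qed.

End Tree.

(** * Displacements along a tropical line *)

Notation chi := beyond_tgt.

Section TropicalSpace.
Variables (R : realType) (n : nat).
Implicit Types (c : TP R n) (u w : 'rV[R]_n).

Lemma pi_eq u w : (exists t : R, u - w = const_mx t) ->
  \pi_(TP R n) u = \pi_(TP R n) w.
Proof. by move=> e; apply/eqmodP; apply/asboolP. Qed.

Lemma pi_eqP u w : \pi_(TP R n) u = \pi_(TP R n) w ->
  exists t : R, u - w = const_mx t.
Proof. by move/eqmodP => /asboolP. Qed.

Lemma repr_tp_add c w : exists t : R, repr (tp_add c w) = repr c + w + const_mx t.
Proof.
have [t E] := pi_eqP (reprK (tp_add c w)); exists t.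
by rewrite -E addrC subrK.
Qed.

Lemma tp_add_eq c u w t : u - w = const_mx t -> tp_add c u = tp_add c w.
Proof. by move=> e; apply: pi_eq; exists t; rewrite opprD addrACA subrr add0r. Qed.

Lemma tp_addA c u w : tp_add (tp_add c u) w = tp_add c (u + w).
Proof.
have [t e] := repr_tp_add c u; apply: pi_eq; exists t; rewrite e.
by apply/rowP => i; rewrite !mxE; ring.
Qed.

Lemma tp_add0 c : tp_add c 0 = c.
Proof. by rewrite /tp_add addr0 reprK. Qed.

Lemma tp_addE c c' w t : repr c' = repr c + w + const_mx t -> c' = tp_add c w.
Proof.
move=> e; rewrite -[LHS]reprK; apply: pi_eq; exists t; rewrite e.
by rewrite addrC addKr.
Qed.

Lemma tp_add_inj c u w : tp_add c u = tp_add c w -> exists t : R, u - w = const_mx t.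
Proof.
move/pi_eqP => [t e]; exists t; rewrite -e.
by rewrite opprD addrACA subrr add0r.
Qed.

End TropicalSpace.

Section Line.
Variables (R : realType) (n : nat) (L : tropical_line R n).
Notation T := (graph L).
Notation rt := (Defs.root T).
Implicit Types (x y u v : vert T) (e f : edge T) (i j : 'I_n) (g : germ T).
Implicit Types (c : TP R n).

Let tree : is_tree T := line_tree L.

(** The sum of the steps along the edges between [u] and [x], with each edge
    directed from [u] to [x]. *)
Definition disp u x : 'rV[R]_n :=
  \row_i \sum_e if sep e u x && (chi e (rt i) == chi e x) then len e else 0.

(** Crossing an edge changes the displacement by the step that the direction of
    this edge prescribes; if the edge leads back towards [u], only up to a
    multiple of [(1, ..., 1)], since [e_I + e_(I^c) = (1, ..., 1)]. *)
Lemma pos_disp u x : pos x = tp_add (pos u) (disp u x).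
Proof.
have d0 : disp u u = 0.
  by apply/rowP => i; rewrite !mxE big1 // => e _; rewrite /sep eqxx.
suff E : tp_add (pos x) (- disp u x) = tp_add (pos u) (- disp u u).
  move: E; rewrite d0 oppr0 tp_add0 => <-.
  by rewrite tp_addA addNr tp_add0.
apply: (edge_invariant tree (g := fun y => tp_add (pos y) (- disp u y))) => e.
rewrite line_direction tp_addA.
apply: (@tp_add_eq _ _ _ _ _ (if chi e u then - len e else 0)).
apply/rowP => i; rewrite !mxE.
rewrite (bigD1 e) //= [X in - (X + _) - _](_ : _ =
  if chi e u && ~~ chi e (rt i) then len e else 0); last first.
  by rewrite /sep (chi_src tree); case: (chi e u); case: (chi e (rt i)).
rewrite [X in _ - (_ - X)](bigD1 e) //= [X in _ - (_ - (X + _))](_ : _ =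
  if ~~ chi e u && chi e (rt i) then len e else 0); last first.
  by rewrite /sep chi_tgt; case: (chi e u); case: (chi e (rt i)).
rewrite [X in - (_ + X) - _](_ : _ = \sum_(f | f != e)
   (if sep f u (tgt e) && (chi f (rt i) == chi f (tgt e)) then len f else 0)); last first.
  by apply: eq_bigr => f fe; rewrite /sep !(chi_other (_ : e != f)) // eq_sym.
rewrite /side inE -/(chi e (rt i)).
by case: (chi e u); case: (chi e (rt i)) => /=; ring.
Qed.

(** The point [c] lies beyond the germ [g] at [v]: it is obtained from [pos v] by
    increasing exactly the coordinates in the class of [g]. *)
Definition displaced v g c : Prop := exists W : 'rV[R]_n,
  [/\ c = tp_add (pos v) W, forall i, i \notin beyond v g -> W 0 i = 0 &
      forall i, i \in beyond v g -> 0 < W 0 i].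

(** Each edge between [u] and [x] increases only coordinates beyond itself, which
    are beyond [e] as well, and [e] increases all of those. *)
Lemma vertex_displaced u x e : inc u e -> sep e x u -> displaced u (inl e) (pos x).
Proof.
move=> ue ex; exists (disp u x); split; first exact: pos_disp.
  move=> i; rewrite inE mxE => ei; apply: big1 => f _.
  case: ifP => // /andP[fx /eqP fi]; case/negP: ei.
  by apply: (sep_nested tree ue ex (e := f)); rewrite /sep ?fi eq_sym.
move=> i; rewrite inE mxE => ei; rewrite (bigD1 e) //= ltr_pwDl //.
  rewrite sepC ex /=; move: ei ex; rewrite /sep.
  by case: (chi e (rt i)); case: (chi e u); case: (chi e x) => //= *; exact: line_len.
by apply: sumr_ge0 => f _; case: ifP => // _; exact/ltW/line_len.
Qed.

Lemma displaced_add v g c (Z : 'rV[R]_n) : displaced v g c ->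
  (forall i, 0 <= Z 0 i) -> (forall i, i \notin beyond v g -> Z 0 i = 0) ->
  displaced v g (tp_add c Z).
Proof.
move=> [W [-> W0 Wp]] Z_ge Z0; exists (W + Z); split; first by rewrite tp_addA.
  by move=> i ig; rewrite mxE W0 // Z0 // addr0.
by move=> i ig; rewrite mxE ltr_pwDl // Wp.
Qed.

Lemma ray_displaced i u g (s : R) : 0 < s -> germ_at u g -> i \in beyond u g ->
  displaced u g (tp_add (pos (rt i)) (s *: e_ R [set i]%SET)).
Proof.
move=> s0 ug ig; have [iu|iu] := eqVneq (rt i) u.
  have -> : g = inr i.
    by apply: (germ_uniq tree ug _ ig); rewrite /= ?iu ?inE.
  exists (s *: e_ R [set i]%SET); rewrite -iu; split=> // j.
    by rewrite /= inE !mxE inE => /negbTE->; rewrite mulr0.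
  by rewrite /= inE !mxE inE => ->; rewrite mulr1.
apply: displaced_add.
- case: g ug ig => [e|j] /= ug; first by rewrite inE; exact: vertex_displaced.
  by rewrite inE => /eqP ij; rewrite ij ug in iu.
- by move=> j; rewrite !mxE mulr_ge0 ?ler0n // ltW.
- by move=> j jg; rewrite !mxE inE (_ : (j == i) = false) ?mulr0 //; apply: contraNF jg => /eqP->.
Qed.

(** The end [x] of the edge is chosen on the same side as [u], so that the step
    from [x] into the edge leads away from [u]. *)
Lemma edge_point_displaced e x u (s : R) : inc x e -> chi e x = chi e u -> 0 < s ->
  exists2 g, germ_at u g &
    displaced u g (tp_add (pos x) (s *: e_ R (beyond x (inl e)))).
Proof.
move=> xe xu s0; have [<-|ux] := eqVneq x u.
  exists (inl e) => //; exists (s *: e_ R (beyond x (inl e))); split=> // i.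
    by rewrite !mxE => /negbTE->; rewrite mulr0.
  by rewrite !mxE => ->; rewrite mulr1.
have [f uf fx] := direction tree ux; exists (inl f) => //.
have fe : f != e by apply: contraTneq fx => ->; rewrite /sep xu eqxx.
apply: displaced_add; first exact: vertex_displaced.
  by move=> j; rewrite !mxE mulr_ge0 ?ler0n // ltW.
move=> j jf; rewrite !mxE (_ : (j \in beyond x (inl e)) = false) ?mulr0 //.
apply: contraNF jf; rewrite !inE => ej.
apply: (sep_nested tree uf (x := other_end e x) (e := e)).
- by rewrite /sep chi_opp_other // -/(sep f x u).
- by rewrite /sep (chi_opp tree) // xu; case: chi.
- by move: ej; rewrite /sep xu.
Qed.

Lemma side_src e : beyond (src e) (inl e) = side e.
Proof. by apply/finset.setP => i; rewrite !inE /sep (chi_src tree) /chi; case: connect. Qed.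

Lemma beyond_tgtE e : beyond (tgt e) (inl e) = (~: side e)%SET.
Proof. by apply/finset.setP => i; rewrite !inE /sep chi_tgt /chi; case: connect. Qed.

Lemma point_displaced u c : points L c ->
  c = pos u \/ exists2 g, germ_at u g & displaced u g c.
Proof.
case=> -[x|e t|i t] /= ok <-.
- have [->|xu] := eqVneq x u; first by left.
  by right; have [e ue ex] := direction tree xu; exists (inl e) => //; exact: vertex_displaced.
- right; case/andP: ok => t0 t1; case eu : (chi e u).
    have -> : tp_add (pos (src e)) (t *: e_ R (side e)) =
        tp_add (pos (tgt e)) ((len e - t) *: e_ R (beyond (tgt e) (inl e))).
      rewrite line_direction tp_addA beyond_tgtE.
      apply: (@tp_add_eq _ _ _ _ _ (t - len e)); apply/rowP => i; rewrite !mxE.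
      by rewrite !finset.in_setC; case: (i \in side e) => /=; ring.
    apply: edge_point_displaced; rewrite ?subr_gt0 ?chi_tgt ?eu //.
    by rewrite /inc eqxx orbT.
  rewrite -side_src; apply: edge_point_displaced; rewrite ?(chi_src tree) //.
  by rewrite /inc eqxx.
- by right; have [g ug ig] := germ_of tree u i; exists g => //; exact: ray_displaced.
Qed.

(** An edge with all leaves on one side would have direction 0, against the
    injectivity of the embedding. *)
Lemma beyond_nonempty v g : germ_at v g -> exists i, i \in beyond v g.
Proof.
case: g => [e|i] /= ve; last by exists i; rewrite inE.
apply: contrapT => none; suff E : pos (src e) = pos (tgt e).
  have := @line_embedded _ _ L (AtVert (src e)) (AtVert (tgt e)) I I E.
  by move=> [/eqP]; rewrite (negbTE (src_tgt tree e)).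
have out i : chi e (rt i) = chi e v.
  by apply/eqP; apply: contraT => ei; case: none; exists i; rewrite inE.
rewrite line_direction -[LHS]tp_add0.
apply: (@tp_add_eq _ _ _ _ _ (if chi e v then - len e else 0)).
apply/rowP => i; rewrite !mxE inE -/(chi e (rt i)) out.
by case: (chi e v); rewrite ?mulr1 ?mulr0 ?sub0r ?oppr0.
Qed.

Lemma different_component v g g' i j : germ_at v g -> germ_at v g' -> g != g' ->
  i \in beyond v g -> j \in beyond v g' -> ~~ same_component v i j.
Proof.
move=> vg vg' gg' ig jg'; apply/negP => /orP[/eqP ij|/and3P[iv jv]].
  by rewrite ij in ig; rewrite (germ_uniq tree vg vg' ig jg') eqxx in gg'.
case: g vg gg' ig => [e|k] /= vg gg' ig; last first.
  by move: ig iv; rewrite inE => /eqP->; rewrite vg.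
case/connectP => p pth E.
have inv x : path (fun x y => [&& adj [set: edge T]%SET x y, x != v & y != v]) x p ->
    chi e (last x p) = chi e x.
  elim: p x {pth E} => //= z p IH x /andP[/and3P[/existsP[f /andP[_ xz]] xv zv] /IH ->].
  have fe : f != e.
    apply: contraTneq vg => <-; rewrite /inc.
    by case/orP: xz => /andP[/eqP-> /eqP->]; rewrite negb_or xv zv.
  by case/orP: xz => /andP[/eqP<- /eqP<-]; rewrite (chi_other fe).
have je : j \in beyond v (inl e).
  by move: ig; rewrite !inE /sep E inv.
by rewrite (germ_uniq tree (g := inl e) vg vg' je jg') eqxx in gg'.
Qed.

Variable a : 'I_n -> 'rV[nat]_3.

Lemma separated_beyond v g : compatible a L -> germ_at v g ->
  separated R a (beyond v g) (~: beyond v g)%SET.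
Proof.
move=> comp vg i i' k l ig i'g ii' kg lg kl.
case: g vg ig i'g kg lg => [e|j] /= vg; last first.
  by rewrite !inE => /eqP ij /eqP i'j; rewrite ij i'j eqxx in ii'.
rewrite !inE => ig i'g kg lg.
have ne (x y : 'I_n) : sep e (rt x) v -> ~~ sep e (rt y) v -> x != y.
  by move=> ex; apply: contraNneq => <-.
apply: comp; split.
  by rewrite /= !inE !negb_or ii' kl !(ne _ _ ig) // !(ne _ _ i'g).
exists e; rewrite !finset.subUset !finset.sub1set !finset.in_setC.
rewrite !inE -!/(chi _ _); move: ig i'g kg lg; rewrite /sep.
by case: (chi e (rt i)); case: (chi e (rt i')); case: (chi e (rt k));
  case: (chi e (rt l)); case: (chi e v).
Qed.

End Line.

(** * Configurations with one point for each vertex *)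

Section Minima.
Variables (R : realType) (n : nat) (a : 'I_n -> 'rV[nat]_3).
Implicit Types (c : TP R n) (P : TP R 3) (S : {set 'I_n}) (s t : 'I_n).

(** Other representatives of [c] and [c0] change all the differences by the same
    amount. *)
Definition nearest S c0 c : {set 'I_n} :=
  [set i in S | [forall j in S, repr c 0 i - repr c0 0 i <= repr c 0 j - repr c0 0 j]]%SET.

Lemma min_termsP S c P s : reflect
  (s \in S /\ forall t, t \in S -> term a c P s <= term a c P t) (s \in min_terms a S c P).
Proof. by rewrite inE; apply: (iffP andP) => -[sS /forall_inP]. Qed.

Lemma nearestP S c0 c s : reflect
  (s \in S /\ forall t, t \in S -> repr c 0 s - repr c0 0 s <= repr c 0 t - repr c0 0 t)
  (s \in nearest S c0 c).
Proof. by rewrite inE; apply: (iffP andP) => -[sS /forall_inP]. Qed.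

(** An index at which both the terms of [c0] and the difference [c - c0] are least
    is minimal for [c], and any other minimal index for [c] has both properties
    as well. *)
Lemma another_nearest S c0 c P s :
  s \in min_terms a [set: 'I_n]%SET c0 P -> s \in nearest S c0 c ->
  (2 <= #|min_terms a S c P|)%N ->
  exists t, [/\ t != s, t \in min_terms a [set: 'I_n]%SET c0 P & t \in nearest S c0 c].
Proof.
move=> /min_termsP[_ smin] /nearestP[sS snear] /card_gt1P[x [y [xm ym xy]]].
have [t ts tm] : exists2 t, t != s & t \in min_terms a S c P.
  by have [xs|xs] := eqVneq x s; [exists y; rewrite // -xs eq_sym | exists x].
move/min_termsP: tm => [tS tmin]; exists t.
have := tmin s sS; have := smin t (finset.in_setT _); have := snear t tS.
rewrite /term; set ds := dot _ _; set dt := dot _ _ => h1 h2 h3.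
split=> //.
  apply/min_termsP; split; first by rewrite inE.
  move=> k _; apply: le_trans (smin k (finset.in_setT _)).
  by rewrite /term -/ds -/dt; lra.
by apply/nearestP; split=> // k kS; have := snear k kS; lra.
Qed.

End Minima.

Section Configuration.
Variables (R : realType) (n : nat) (L : tropical_line R n).
Variables (a : 'I_n -> 'rV[nat]_3) (C : vert (graph L) -> TP R 3).
Notation T := (graph L).
Notation rt := (Defs.root T).
Implicit Types (x y u v : vert T) (e f : edge T) (i j k s t : 'I_n) (g : germ T).
Implicit Types (c : TP R n).

Let tree : is_tree T := line_tree L.

(** The terms that are minimal at the point of [v] for the coefficients [v]; they
    label the triangle of the subdivision that is dual to this point. *)
Definition triangle v : {set 'I_n} := min_terms a [set: 'I_n]%SET (pos v) (C v).

Hypothesis val3 : trivalent L.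
Hypothesis triangle_meets : forall v g, germ_at v g ->
  exists2 i, i \in triangle v & i \in beyond v g.
Hypothesis triangle_card : forall v, (#|triangle v| <= 3)%N.

Lemma card_germs v : #|[set g | germ_at v g]%SET| = 3%N.
Proof. by rewrite -valenceE // val3. Qed.

Lemma some_germ v : exists g, germ_at v g.
Proof.
have : (0 < #|[set g | germ_at v g]%SET|)%N by rewrite card_germs.
by case/card_gt0P => g; rewrite inE; exists g.
Qed.

Lemma two_other_germs v g : exists g1 g2,
  [/\ germ_at v g1, germ_at v g2, g1 != g, g2 != g & g1 != g2].
Proof.
have : (1 < #|[set g | germ_at v g] :\ g|)%N%SET.
  have := cardsD1 g [set g | germ_at v g]%SET; rewrite card_germs.
  by case: (g \in _) => /=; lia.
by case/card_gt1P => g1 [g2 []]; rewrite !inE => /andP[? ?] /andP[? ?] ?; exists g1, g2.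
Qed.

Lemma only_three_germs v g1 g2 g3 g :
  germ_at v g1 -> germ_at v g2 -> germ_at v g3 -> g1 != g2 -> g1 != g3 -> g2 != g3 ->
  germ_at v g -> [\/ g = g1, g = g2 | g = g3].
Proof.
move=> v1 v2 v3 g12 g13 g23 vg.
suff /or3P[] : [|| g == g1, g == g2 | g == g3].
- by move/eqP; constructor 1.
- by move/eqP; constructor 2.
- by move/eqP; constructor 3.
apply: contraT; rewrite !negb_or => /and3P[n1 n2 n3].
have distinct : uniq [:: g; g1; g2; g3].
  by rewrite /= !inE !negb_or n1 n2 n3 g12 g13 g23.
have : (#|[:: g; g1; g2; g3]| <= 3)%N.
  rewrite -(card_germs v); apply/subset_leq_card/fintype.subsetP => x.
  by rewrite !inE => /or4P[] /eqP->.
by rewrite (card_uniqP distinct).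
Qed.

Lemma triangle_pick v : exists r : germ T -> 'I_n,
  (forall g, germ_at v g -> r g \in triangle v /\ r g \in beyond v g) /\
  {in [set g | germ_at v g]%SET &, injective r}.
Proof.
have [g0 vg0] := some_germ v; have [i0 _ _] := triangle_meets vg0.
have /choice[r rP] g : exists i, germ_at v g -> i \in triangle v /\ i \in beyond v g.
  have [vg|vg] := boolP (germ_at v g); last by exists i0.
  by have [i iM ig] := triangle_meets vg; exists i.
exists r; split=> // g1 g2; rewrite !inE => vg1 vg2 E.
have [_ r1] := rP _ vg1; have [_ r2] := rP _ vg2; rewrite -E in r2.
exact: (germ_uniq tree vg1 vg2 r1 r2).
Qed.

(** The triple has three members and meets each of the three classes at [v], so
    it meets each class once. *)
Lemma triangle_inj v g s t : germ_at v g -> s \in triangle v -> t \in triangle v ->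
  s \in beyond v g -> t \in beyond v g -> s = t.
Proof.
move=> vg sM tM sg tg; have [r [rP injr]] := triangle_pick v.
have sub : (r @: [set g' | germ_at v g'] \subset triangle v)%SET.
  by apply/fintype.subsetP => _ /imsetP[g' + ->]; rewrite inE => /rP[].
have /eqP E : (r @: [set g' | germ_at v g'])%SET == triangle v.
  by rewrite eqEcard sub card_in_imset // card_germs triangle_card.
have hit i : i \in triangle v -> i \in beyond v g -> i = r g.
  rewrite -E => /imsetP[g']; rewrite inE => vg' -> ig.
  by have [_ /(germ_uniq tree vg vg' ig) ->] := rP _ vg'.
by rewrite (hit s) // (hit t).
Qed.

Lemma triangle_gt2 v : (3 <= #|triangle v|)%N.
Proof.
have [r [rP injr]] := triangle_pick v.
rewrite -(card_germs v) -(card_in_imset injr).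
by apply/subset_leq_card/fintype.subsetP => _ /imsetP[g' + ->]; rewrite inE => /rP[].
Qed.

(** Passing from [pos v] to [c] raises the terms beyond [g] and no others. The
    minimum stays the same, because the triple has members outside this class. *)
Lemma min_displaced v g c : germ_at v g -> displaced v g c ->
  min_terms a [set: 'I_n]%SET c (C v) = (triangle v :\: beyond v g)%SET.
Proof.
move=> vg [W [cE W0 Wp]]; have [r rE] := repr_tp_add (pos v) W.
have hE s : term a c (C v) s = term a (pos v) (C v) s + W 0 s + r.
  by rewrite /term cE rE !mxE; ring.
have [g1 [_ [vg1 _ g1g _ _]]] := two_other_germs v g.
have [m mM mg1] := triangle_meets vg1.
have mg : m \notin beyond v g by apply: (beyond_disjoint tree vg vg1) => //; rewrite eq_sym.
have [_ mmin] := min_termsP _ _ _ _ _ mM.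
have Wge s : 0 <= W 0 s.
  by have [/Wp/ltW//|/W0->//] := boolP (s \in beyond v g).
apply/finset.setP => s; rewrite finset.in_setD; apply/min_termsP/andP.
  case=> _ smin; have := smin m (finset.in_setT _); have := mmin s (finset.in_setT _).
  rewrite !hE (W0 m mg) => h1 h2.
  have sg : s \notin beyond v g by apply/negP => /Wp; lra.
  split=> //; apply/min_termsP; split; first by rewrite inE.
  move=> t /mmin; rewrite W0 // in h2; lra.
case=> sg /min_termsP[_ smin]; split; first by rewrite inE.
by move=> t /smin; rewrite !hE W0 //; have := Wge t; lra.
Qed.

Lemma line_sub_through c v : points L c ->
  (2 <= #|min_terms a [set: 'I_n]%SET c (C v)|)%N.
Proof.
move=> Lc; have [->|[g vg dg]] := point_displaced v Lc.
  exact: leq_trans (triangle_gt2 v).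
have [g1 [g2 [vg1 vg2 g1g g2g g12]]] := two_other_germs v g.
have [s sM sg] := triangle_meets vg1; have [t tM tg] := triangle_meets vg2.
rewrite (min_displaced vg dg); apply/card_gt1P; exists s, t.
rewrite !finset.in_setD sM tM !andbT; split.
- by apply: (beyond_disjoint tree vg vg1) => //; rewrite eq_sym.
- by apply: (beyond_disjoint tree vg vg2) => //; rewrite eq_sym.
- by apply: contraNneq (beyond_disjoint tree vg1 vg2 g12 tg) => <-.
Qed.

Lemma card_away v g : germ_at v g -> (#|triangle v :\: beyond v g|%SET <= 2)%N.
Proof.
move=> vg; have [m mM mg] := triangle_meets vg.
have : (triangle v :\: beyond v g \subset triangle v :\ m)%SET.
  apply/fintype.subsetP => s; rewrite !inE => /andP[sg sM]; rewrite sM andbT.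
  by apply: contraNneq sg => ->.
move/subset_leq_card => /leq_trans; apply.
by have := triangle_card v; rewrite (cardsD1 m) mM; lia.
Qed.

(** For the coefficients [pos u], three terms are minimal at the point of [u], but
    only two at the point of any other vertex. *)
Lemma points_distinct : injective C.
Proof.
move=> u v E; apply/eqP; apply: contraT => uv.
have [e ve eu] := direction tree uv.
have := triangle_gt2 u; rewrite /triangle E.
rewrite (min_displaced (g := inl e) ve (vertex_displaced ve eu)) => /leq_trans.
by move/(_ _ (card_away (g := inl e) ve)).
Qed.

Implicit Types D : {set 'I_n}.

(** The set [D] does not distinguish the two members of the triple away from
    [g], which ties the classes of these two members together. *)
Definition balanced D v g : Prop := forall s t,
  s \in (triangle v :\: beyond v g)%SET -> t \in (triangle v :\: beyond v g)%SET ->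
  (s \in D) = (t \in D).

Lemma nearest_balanced S c0 c v g : germ_at v g -> displaced v g c0 ->
  (2 <= #|min_terms a S c (C v)|)%N -> balanced (nearest S c0 c) v g.
Proof.
move=> vg dg big s t sM tM; have small := card_away vg.
suff imp (x y : 'I_n) : x \in (triangle v :\: beyond v g)%SET ->
    y \in (triangle v :\: beyond v g)%SET -> x \in nearest S c0 c -> y \in nearest S c0 c.
  by apply/idP/idP; exact: imp.
move=> xM yM xD; have [<-//|xy] := eqVneq x y.
have ME := min_displaced vg dg.
have xM' := xM; rewrite -ME in xM'.
have [z [zx]] := another_nearest xM' xD big; rewrite ME => zM zD.
have [<-//|zy] := eqVneq z y; move: small; rewrite leqNgt => /card_gt2P.
case; exists x, y, z; split; split=> //; by rewrite eq_sym.
Qed.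

(** Induction on the branch beyond [g]: if [g] is an edge to [y], then the two
    other germs at [y] have branches on which membership in [D] is constant, and
    the triple of [y] has one member in each of them, which are tied together. *)
Lemma const_branch D u0 :
  (forall x f, inc x f -> sep f u0 x -> balanced D x (inl f)) ->
  forall x g, germ_at x g -> (forall f, g = inl f -> ~~ sep f u0 x) ->
  forall s t, s \in beyond x g -> t \in beyond x g -> (s \in D) = (t \in D).
Proof.
move=> bal x g; have [N] := ubnP #|beyond x g|.
elim: N x g => // N IH x [e|i]; last first.
  by move=> _ _ _ s t; rewrite !inE => /eqP-> /eqP->.
rewrite ltnS => cN xe away.
have {}away : ~~ sep e u0 x by exact: away.
pose y := other_end e x; have ye : inc y e by exact: inc_opp.
(* seen from y, the edge e leads to u0 *)
have u0y : sep e u0 y by rewrite sep_opp.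
have flip i : (i \in beyond x (inl e)) = (i \notin beyond y (inl e)).
  by rewrite !inE sep_opp // negbK.
have rep s : s \in beyond x (inl e) ->
    exists2 m, m \in (triangle y :\: beyond y (inl e))%SET & (s \in D) = (m \in D).
  move=> sx; have [g yg sg] := germ_of tree y s.
  have ge : inl e != g by apply: contraTneq sx => E; rewrite flip E negbK.
  have [m mM mg] := triangle_meets yg.
  exists m; first by rewrite finset.in_setD mM andbT (beyond_disjoint tree (g := inl e) ye yg).
  apply: (IH y g) => //; last first.
    move=> f gf; rewrite gf /= in yg ge; apply/negP => fs.
    by rewrite (direction_uniq tree ye u0y yg fs) eqxx in ge.
  apply: leq_trans cN; apply: proper_card; apply/properP; split.
    apply/fintype.subsetP => k kg; rewrite flip.
    exact: (beyond_disjoint tree (g := inl e) ye yg).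
  have [g1 [g2 [yg1 yg2 g1e g2e g12]]] := two_other_germs y (inl e).
  have [g3 [yg3 g3e g3g]] : exists g3, [/\ germ_at y g3, g3 != inl e & g3 != g].
    by have [E|E] := eqVneq g1 g; [exists g2; split=> //; rewrite -E eq_sym | exists g1].
  have [k kg3] := beyond_nonempty yg3; exists k.
    by rewrite flip (beyond_disjoint tree (g := inl e) ye yg3) // eq_sym.
  by apply: (beyond_disjoint tree yg yg3) => //; rewrite eq_sym.
move=> s t /rep[m mM ->] /rep[m' mM' ->].
exact: (bal y e ye u0y m m').
Qed.

Lemma const_away D u0 g0 :
  (forall x f, inc x f -> sep f u0 x -> balanced D x (inl f)) ->
  germ_at u0 g0 -> balanced D u0 g0 ->
  forall s t, s \notin beyond u0 g0 -> t \notin beyond u0 g0 -> (s \in D) = (t \in D).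
Proof.
move=> bal ug0 bal0.
have rep s : s \notin beyond u0 g0 ->
    exists2 m, m \in (triangle u0 :\: beyond u0 g0)%SET & (s \in D) = (m \in D).
  move=> s0; have [g ug sg] := germ_of tree u0 s.
  have gg0 : g0 != g by apply: contraNneq s0 => ->.
  have [m mM mg] := triangle_meets ug.
  exists m; first by rewrite finset.in_setD mM andbT (beyond_disjoint tree ug0 ug).
  by apply: (const_branch bal ug) => // f _; rewrite /sep eqxx.
by move=> s t /rep[m mM ->] /rep[m' mM' ->]; exact: bal0.
Qed.

Lemma exists_nearest (S : {set 'I_n}) c0 c s : s \in S -> exists t, t \in nearest S c0 c.
Proof.
move=> sS; case: (arg_minP (fun i => repr c 0 i - repr c0 0 i) sS) => t tS min.
by exists t; apply/nearestP.
Qed.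

(** Compare [c] with a point [c0] on the ray [i]. Seen from the start of this ray,
    all the other leaves are tied together, so the set of nearest indices either
    contains [j] or contains no index but [i]; both are excluded. *)
Lemma no_curve_missing_two i j c : i != j -> (3 <= n)%N ->
  ~ forall v, (2 <= #|min_terms a (~: [set i; j])%SET c (C v)|)%N.
Proof.
move=> ij n3 big; set S := (~: [set i; j])%SET.
(* any positive distance along the ray would do *)
pose c0 := tp_add (pos (rt i)) (1 *: e_ R [set i]%SET).
pose D := nearest S c0 c.
have bal x f : inc x f -> sep f (rt i) x -> balanced D x (inl f).
  move=> xf fi; apply: nearest_balanced => //.
  by apply: ray_displaced; rewrite ?ltr01 // inE.
have ri : germ_at (rt i) (inr i) by rewrite /= eqxx.
have bal0 : balanced D (rt i) (inr i).
  by apply: nearest_balanced => //; apply: ray_displaced; rewrite ?ltr01 // inE.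
have [k kS] : exists k, k \in S.
  apply/card_gt0P; have := cardsC [set i; j]%SET; rewrite cards2 ij card_ord.
  by rewrite -/S; lia.
have [s sD] := exists_nearest c0 c kS.
have sS : s \in S by case/nearestP: sD.
have si : s \notin beyond (rt i) (inr i).
  by move: sS; rewrite !inE negb_or => /andP[].
have ji : j \notin beyond (rt i) (inr i) by rewrite inE eq_sym.
have := const_away bal ri bal0 si ji; rewrite -/D in sD; rewrite sD.
by move/esym/nearestP => -[]; rewrite !inE eqxx orbT.
Qed.

(** Compare [c] with [pos v]. The set of nearest indices is a union of classes at
    [v], and it contains at least two of them because its member in the triple of
    [v] is not alone. *)
Lemma through_displaced v c :
  (forall u, 2 <= #|min_terms a [set: 'I_n]%SET c (C u)|)%N ->
  c = pos v \/ exists2 g, germ_at v g & displaced v g c.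
Proof.
move=> big; set S := [set: 'I_n]%SET in big; pose D := nearest S (pos v) c.
have bal x f : inc x f -> sep f v x -> balanced D x (inl f).
  by move=> xf fv; apply: nearest_balanced => //; exact: vertex_displaced.
have cst g : germ_at v g -> forall s t, s \in beyond v g -> t \in beyond v g ->
    (s \in D) = (t \in D).
  by move=> vg; apply: (const_branch bal vg) => f _; rewrite /sep eqxx.
have [g0 /triangle_meets[i0 _ _]] := some_germ v.
have [s sD] := exists_nearest (pos v) c (finset.in_setT i0).
pose d := repr c 0 s - repr (pos v) 0 s.
have [_ smin] := nearestP _ _ _ _ sD.
have DE i : (i \in D) = (repr c 0 i - repr (pos v) 0 i == d).
  apply/nearestP/eqP => [[_ imin]|iE].
    by apply/le_anti; rewrite imin ?smin ?inE.
  by split=> [|t tS]; [rewrite inE | rewrite iE; exact: smin].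
have dle i : d <= repr c 0 i - repr (pos v) 0 i by apply: smin; rewrite inE.
have [gs vgs sgs] := germ_of tree v s.
have [m mM mgs] := triangle_meets vgs.
have mD : m \in D by rewrite (cst gs vgs m s).
have [m' [mm' m'M m'D]] := another_nearest mM mD (big v).
have [gt vgt m'gt] := germ_of tree v m'.
have gst : gs != gt.
  by apply: contraNneq mm' => E; rewrite E in mgs; rewrite (triangle_inj vgt m'M mM m'gt mgs).
have inD i g : germ_at v g -> i \in beyond v g -> g = gs \/ g = gt -> i \in D.
  by move=> vg ig [] E; rewrite E in ig; [rewrite (cst gs vgs i s)|rewrite (cst gt vgt i m')].
pose W : 'rV[R]_n := \row_i (repr c 0 i - repr (pos v) 0 i - d).
have cW : c = tp_add (pos v) W.
  by apply: (@tp_addE _ _ _ _ _ d); apply/rowP => i; rewrite !mxE; ring.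
have [full|notall] := pselect (forall i, i \in D).
  left; rewrite cW -[RHS]tp_add0; apply: (@tp_add_eq _ _ _ _ _ 0).
  apply/rowP => i; rewrite !mxE; have := full i; rewrite DE => /eqP->; ring.
have [i iD] : exists i, i \notin D.
  by apply: contrapT => none; apply: notall => j; apply: contraT => jD; case: none; exists j.
right; have [g vg ig] := germ_of tree v i; exists g => //.
have ggs : g != gs by apply: contraNneq iD => E; apply: (inD i g) => //; left.
have ggt : g != gt by apply: contraNneq iD => E; apply: (inD i g) => //; right.
have only3 g' : germ_at v g' -> g' != g -> g' = gs \/ g' = gt.
  move=> vg' g'g; have [E|->|->] := only_three_germs vg vgs vgt ggs ggt gst vg'; auto.
  by rewrite E eqxx in g'g.
exists W; split=> // k kg; rewrite mxE.
  have [g' vg' kg'] := germ_of tree v k.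
  have g'g : g' != g by apply: contraNneq kg => <-.
  have := inD k g' vg' kg' (only3 _ vg' g'g); rewrite DE => /eqP->; exact: subrr.
rewrite subr_gt0 lt_neqAle dle andbT eq_sym -DE.
by rewrite (cst g vg k i).
Qed.

(** Two displacements towards each other from the ends of an edge: their
    difference is the step along the edge, so the first one is a multiple of that
    step, with a factor smaller than the length. *)
Lemma edge_case e u v c (W W' : 'rV[R]_n) : u = src e -> tgt e = v ->
  c = tp_add (pos u) W -> c = tp_add (pos v) W' ->
  (forall i, i \notin beyond u (inl e) -> W 0 i = 0) ->
  (forall i, i \in beyond u (inl e) -> 0 < W 0 i) ->
  (forall i, i \notin beyond v (inl e) -> W' 0 i = 0) ->
  (forall i, i \in beyond v (inl e) -> 0 < W' 0 i) -> points L c.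
Proof.
move=> -> <-; rewrite side_src beyond_tgtE => cW cW' W0 Wp W'0 W'p.
have [p pe] : exists i, i \in side e.
  have [|i] := @beyond_nonempty _ _ L (src e) (inl e); first by rewrite /= /inc eqxx.
  by rewrite side_src; exists i.
have [q qe] : exists i, i \in (~: side e)%SET.
  have [|i] := @beyond_nonempty _ _ L (tgt e) (inl e).
    by rewrite /= /inc eqxx orbT.
  by rewrite beyond_tgtE; exists i.
have [k E] : exists k : R, W - (len e *: e_ R (side e) + W') = const_mx k.
  by apply: (@tp_add_inj _ _ (pos (src e))); rewrite -cW cW' line_direction tp_addA.
have Ei i : W 0 i - (len e * (i \in side e)%:R + W' 0 i) = k.
  by have := congr1 (fun w : 'rV[R]_n => w 0 i) E; rewrite !mxE.
have side_W' i : i \in side e -> W' 0 i = 0.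
  by move=> ie; apply: W'0; rewrite finset.in_setC negbK.
have W_side i : i \in side e -> W 0 i = len e + k.
  by move=> ie; have := Ei i; rewrite ie (side_W' i ie) /= mulr1; lra.
exists (OnEdge e (len e + k)).
  rewrite /= -(W_side p pe) Wp //=.
  have := Ei q; have := W'p q qe; move: qe; rewrite finset.in_setC => qe.
  by rewrite (W0 q qe) (W_side p pe) (negbTE qe) /= mulr0; lra.
rewrite /= cW; congr tp_add; apply/rowP => i; rewrite !mxE.
have [ie|ie] := boolP (i \in side e); first by rewrite W_side //= mulr1.
by rewrite W0 //= mulr0.
Qed.

(** There are fewer edges than vertices; so if no vertex points along a ray, two
    vertices point along the same edge. *)
Lemma through_sub_line c (i0 : 'I_n) :
  (forall u, 2 <= #|min_terms a [set: 'I_n]%SET c (C u)|)%N -> points L c.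
Proof.
move=> big.
have [[v ->]|nv] := pselect (exists v, c = pos v); first by exists (AtVert v).
have dis v : exists2 g, germ_at v g & displaced v g c.
  by have [E|//] := through_displaced v big; case: nv; exists v.
have [[v [i [vi [W [cW W0 Wp]]]]]|noray] := pselect (exists v i,
    germ_at v (inr i) /\ displaced v (inr i) c).
  exists (OnRay L i (W 0 i)); first by apply: Wp; rewrite inE.
  rewrite /= cW (eqP vi); congr tp_add; apply/rowP => k; rewrite !mxE inE.
  have [->|ki] := eqVneq k i; first by rewrite mulr1.
  by rewrite mulr0 W0 // inE.
have /choice[r rP] v : exists e, inc v e /\ displaced v (inl e) c.
  have [[e|i] vg dg] := dis v; first by exists e.
  by case: noray; exists v, i.
have [u [v [uv E]]] : exists u v, u != v /\ r u = r v.
  apply: contrapT => none; have inj : injective r.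
    move=> u v E; apply/eqP; apply: contraT => uv; case: none; by exists u, v.
  by have := leq_card r inj; rewrite (card_edges tree (rt i0)) ltnn.
have [ue [W [cW W0 Wp]]] := rP u; have [ve [W' [cW' W'0 W'p]]] := rP v.
rewrite -E in ve W'0 W'p; move: ue ve W0 Wp W'0 W'p; move: (r u) => e {E r rP}.
have [us|us] := eqVneq u (src e); last first.
  have [vs|vs] := eqVneq v (src e); last first.
    rewrite /inc ![src e == _]eq_sym (negbTE us) (negbTE vs) /= => /eqP tu /eqP tv.
    by rewrite -tu tv eqxx in uv.
  rewrite /inc ![src e == _]eq_sym (negbTE us) /= => /eqP tu _ W0 Wp W'0 W'p.
  exact: (edge_case vs tu cW' cW W'0 W'p W0 Wp).
rewrite /inc => _; rewrite -us (negbTE uv) /= => /eqP tv W0 Wp W'0 W'p.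
exact: (edge_case us tv cW cW' W0 Wp W'0 W'p).
Qed.

End Configuration.

(** * The configuration of a compatible line *)

Section VertexPoint.
Variables (R : realType) (d n : nat) (a : 'I_n -> 'rV[nat]_3).
Variable L : tropical_line R n.
Hypothesis inja : injective a.
Hypothesis hom : forall i, (\sum_k a i ord0 k)%N = d.
Hypothesis planar : conv_dim (pt R a) [set: 'I_n]%SET = 2%N.
Hypothesis comp : compatible a L.
Hypothesis val3 : trivalent L.
Hypothesis maxD :
  forall v : vert L, maximal_subdivision a (regular_subdivision a (pos v)).

Lemma pt_inj : injective (pt R a).
Proof.
move=> i j /rowP E; apply: inja; apply/rowP => k; have := E k.
by rewrite !mxE => /eqP; rewrite eqr_nat => /eqP.
Qed.

Lemma height_shift (w : 'rV[R]_n) (P : 'rV[R]_3) t i :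
  height a w i (P + const_mx t) = height a w i P + d%:R * t.
Proof. by rewrite /height dotDr (dot_const hom) addrA. Qed.

Lemma min_terms_pi (c : TP R n) (P : 'rV[R]_3) :
  min_terms a [set: 'I_n]%SET c (\pi_(TP R 3) P) = lows a c P.
Proof.
have [t E] := pi_eqP (reprK (\pi_(TP R 3) P)).
have {}E : repr (\pi_(TP R 3) P) = P + const_mx t by rewrite -E addrC subrK.
apply/finset.setP => i; rewrite !inE /=; apply/forall_inP/forallP => h j.
  by have := h j (finset.in_setT _); rewrite /term -!/(height a _ _ _) E !height_shift lerD2r.
by move=> _; rewrite /term -!/(height a _ _ _) E !height_shift lerD2r.
Qed.

(** The three classes at [v] are separated from their complements by the edges at
    [v], so [tricolored_point] applies to the coefficients [pos v]. *)
Lemma vertex_point (i0 : 'I_n) (v : vert L) : exists P : TP R 3,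
  (forall g, germ_at v g -> exists2 i, i \in triangle a (fun=> P) v & i \in beyond v g) /\
  (#|triangle a (fun=> P) v| <= 3)%N.
Proof.
have tree := line_tree L.
have [g1 v1 _] := germ_of tree v i0.
have [g2 [g3 [v2 v3 g21 g31 g23]]] := two_other_germs val3 v g1.
have g12 : g1 != g2 by rewrite eq_sym.
have g13 : g1 != g3 by rewrite eq_sym.
have g32 : g3 != g2 by rewrite eq_sym.
have part : partition3 (beyond v g1) (beyond v g2) (beyond v g3).
  move=> i; have [g vg ig] := germ_of tree v i.
  have [E|E|E] := only_three_germs val3 v1 v2 v3 g12 g13 g23 vg;
    rewrite {g}E in vg ig.
  - by constructor 1; split=> //; apply: (beyond_disjoint tree _ _ _ ig).
  - by constructor 2; split=> //; apply: (beyond_disjoint tree _ _ _ ig).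
  - by constructor 3; split=> //; apply: (beyond_disjoint tree _ _ _ ig).
have [_ vertices] := maxD v.
have strict i := vertex_strict pt_inj (vertices i).
have [i1 h1] := beyond_nonempty v1; have [i2 h2] := beyond_nonempty v2.
have [i3 h3] := beyond_nonempty v3.
have [P [i [j [k [ig jg kg [iP jP kP]]]]]] :=
  tricolored_point pt_inj hom planar strict part (separated_beyond comp v1)
    (separated_beyond comp v2) (separated_beyond comp v3) h1 h2 h3.
have low x : lowest (height a (repr (pos v))) [set: 'I_n]%SET x P ->
    x \in triangle a (fun=> \pi_(TP R 3) P) v.
  by move=> xP; rewrite /triangle min_terms_pi inE; apply/forallP => y; exact: xP.
exists (\pi_(TP R 3) P); split; last first.
  by rewrite /triangle min_terms_pi; exact: (card_lows pt_inj planar (maxD v)).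
move=> g vg; have [->|->|->] := only_three_germs val3 v1 v2 v3 g12 g13 g23 vg.
- by exists i => //; exact: low.
- by exists j => //; exact: low.
- by exists k => //; exact: low.
Qed.

End VertexPoint.

Theorem theorem1p2 (R : realType) (d n : nat) (a : 'I_n -> 'rV[nat]_3)
    (L : tropical_line R n) :
  (3 <= n)%N ->
  injective a ->
  (forall i, (\sum_k a i ord0 k)%N = d) ->
  conv_dim (pt R a) [set: 'I_n]%SET = 2%N ->
  compatible a L ->
  trivalent L ->
  (forall v : vert L, maximal_subdivision a (regular_subdivision a (pos v))) ->
  exists C : 'I_(n - 2) -> TP R 3,
    [/\ injective C,
        general a C,
        points L = line_through a C &
        forall k, at_trivalent_vertex a L (C k)].
Proof.
move=> n3 inja hom planar comp val3 maxD.
have n0 : (0 < n)%N by apply: leq_trans n3.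
pose i0 := Ordinal n0; have tree := line_tree L.
have /choice[P hP] := vertex_point inja hom planar comp val3 maxD i0.
have meets v g : germ_at v g -> exists2 i, i \in triangle a P v & i \in beyond v g.
  by case: (hP v) => + _; apply.
have card3 v : (#|triangle a P v| <= 3)%N by case: (hP v).
have cardV := card_vert tree n0 val3.
pose V (k : 'I_(n - 2)) : vert L := enum_val (cast_ord (esym cardV) k).
have V_inj : injective V by move=> k l /enum_val_inj /cast_ord_inj.
have V_onto v : exists k, v = V k.
  exists (cast_ord cardV (enum_rank v)).
  by rewrite /V cast_ordK enum_rankK.
exists (P \o V); split.
- by move=> k l /(points_distinct val3 meets card3) /V_inj.
- move=> i j ij [c through]; apply: (no_curve_missing_two val3 meets card3 (c := c) ij n3).
  by move=> v; have [k ->] := V_onto v; exact: through.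
- apply/seteqP; split=> c.
    by move=> Lc k; exact: line_sub_through.
  move=> through; apply: (through_sub_line val3 meets card3 i0) => v.
  by have [k ->] := V_onto v; exact: through.
- move=> k; exists (V k).
  have [g1 v1 _] := germ_of tree (V k) i0.
  have [g2 [g3 [v2 v3 g21 g31 g23]]] := two_other_germs val3 (V k) g1.
  have [i iM ig] := meets _ _ v1; have [j jM jg] := meets _ _ v2.
  have [l lM lg] := meets _ _ v3.
  exists i, j, l; split; first exact: val3.
    split.
    + by apply: (different_component v1 v2) => //; rewrite eq_sym.
    + by apply: (different_component v1 v3) => //; rewrite eq_sym.
    + exact: (different_component v2 v3).
  rewrite -[min_terms _ _ _ _]/(triangle a P (V k)).
  by rewrite !finset.subUset !finset.sub1set iM jM lM.
Qed.
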